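(* Let $n\ge4$ and let $T$ be a triangulation of the $n$-gon (the seed triangulation), with set of diagonals $\overline T$, $|\overline T|=n-3$. Then the projection $\phi\circ\pi:\mathrm{Pf}_1^+(n)\to\mathbb{R}^{\overline T}\cong\mathbb{R}^{n-3}$ gives a realization of the $(n-3)$-dimensional associahedron in $\mathbb{R}^{n-3}$: the cones generated by $\{\overline W_{a,b}:\{a,b\}\in\overline{T'}\}$, for $T'$ ranging over the triangulations of the $n$-gon, are the maximal cones of a complete simplicial fan which is the normal fan of a polytope. This polytope (whose facet corresponding to the diagonal $\{a,b\}$ has outer normal $\overline W_{a,b}$) has the following properties: (1) It has $n-3$ pairs of parallel facets, each pair consisting of the facet corresponding to a diagonal $\{a,b\}$ of $T$ and the facet corresponding to its rotation $\{a+1,b+1\}$. (2) Taking the normals $\overline W_{a,b}$, $\{a,b\}\in\overline T$, to those $n-3$ pairs as a linear basis for $\mathbb{R}^{n-3}$, all other facet normals lie in $\{0,\pm1\}^{n-3}$.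
   Context: Indices in $[n]$ are modulo $n$. Edges $\{i,j\},\{i',j'\}$ with $i<j$, $i'<j'$ cross if $i<i'<j<j'$ or $i'<i<j'<j$. A triangulation of the $n$-gon is a maximal set $T\subset\binom{[n]}{2}$ of pairwise non-crossing edges; it has $2n-3$ edges, including the $n$ boundary edges $\{i,i+1\}$; $\overline T$ is its set of $n-3$ diagonals (edges that are not boundary edges). $\mathrm{Pf}_1^+(n)$ is the set of $v\in\mathbb{R}^{\binom{[n]}{2}}$ such that for all $a<a'<b<b'$ in $[n]$ the maximum of $v_{a,b}+v_{a',b'}$, $v_{a,a'}+v_{b,b'}$, $v_{a,b'}+v_{a',b}$ is attained at least twice and is attained by $v_{a,b}+v_{a',b'}$. For $\{i,j\}\in\binom{[n]}{2}$ let $W_{i,j}\in\mathbb{R}^{\binom{[n]}{2}}$ be the vector whose $\{a,b\}$-coordinate is $1$ if exactly one of $a,b$ lies in the cyclic interval $\{i,i+1,\dots,j-1\}$, and $0$ otherwise. (That is, $W_{i,j}$ records which pairs of vertices are separated by cutting the polygon at its sides $i$ and $j$, the $a$-th side being $\{a-1,a\}$.) The maximal cones of $\mathrm{Pf}_1^+(n)$ are $L_n+\mathrm{cone}\{W_{a,b}:\{a,b\}\in\overline{T'}\}$ for triangulations $T'$, where $L_n=\mathrm{span}\{W_{i,i+1}:i\in[n]\}$. $\pi:\mathbb{R}^{\binom{[n]}{2}}\to\mathbb{R}^{T}$ keeps the coordinates indexed by $T$. $\phi:\mathbb{R}^T\to\mathbb{R}^{\overline T}\cong\mathbb{R}^{n-3}$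 is a surjective linear map with kernel $\pi(L_n)$ (which has dimension $n$). $\overline W_{a,b}:=\phi(\pi(W_{a,b}))$. *)

(* Defs.v *)
From mathcomp Require Import all_boot all_order all_algebra.
From mathcomp Require Import boolp classical_sets functions cardinality reals.

Set Implicit Arguments.
Unset Strict Implicit.
Unset Printing Implicit Defensive.

Import Order.TTheory GRing.Theory Num.Theory.

Local Open Scope ring_scope.
Local Open Scope classical_set_scope.

(* The vertices of the n-gon are 0, ..., n-1 (rather than 1, ..., n), with
   [ordS] as cyclic successor; an unordered pair {i, j} is stored as (i, j)
   with i < j. *)
Definition edge (n : nat) := {p : 'I_n * 'I_n | (p.1 < p.2)%N}.

Definition mkedge n (i j : 'I_n) (lt_ij : (i < j)%N) : edge n :=
  exist (fun p : 'I_n * 'I_n => (p.1 < p.2)%N) (i, j) lt_ij.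

Section Polygon.
Variable n : nat.
Implicit Types (e f : edge n) (S T : {set edge n}).

Definition lo e : 'I_n := (val e).1.
Definition hi e : 'I_n := (val e).2.

Definition cross e f : bool :=
  [&& lo e < lo f, lo f < hi e & hi e < hi f]%N
  || [&& lo f < lo e, lo e < hi f & hi f < hi e]%N.

Definition noncrossing S : bool :=
  [forall e in S, forall f in S, ~~ cross e f].

Definition triangulation T : bool := maxset noncrossing T.

Definition boundary e : bool := (hi e == ordS (lo e)) || (lo e == ordS (hi e)).

Definition diagonals S : {set edge n} := [set e in S | ~~ boundary e]%SET.

Definition dissection S : bool :=
  noncrossing S && [forall e in S, ~~ boundary e].

Lemma rotate_subproof e :
  let p := if (ordS (lo e) < ordS (hi e))%N then (ordS (lo e), ordS (hi e))
           else (ordS (hi e), ordS (lo e)) in (p.1 < p.2)%N.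
Proof.
case: ifP => [//|/negbT] lt_hl; rewrite /fst /snd ltn_neqAle leqNgt lt_hl andbT.
apply: contraTneq (valP e) => /ord_inj/ordS_inj.
by rewrite -/(lo e) -/(hi e) => ->; rewrite ltnn.
Qed.

Definition rotate e : edge n :=
  exist (fun p : 'I_n * 'I_n => (p.1 < p.2)%N) _ (rotate_subproof e).

(* The cyclic interval {i, i+1, ..., j-1}. *)
Definition cyc_interval (i j : 'I_n) : {set 'I_n} :=
  [set k : 'I_n | ((k + n - i) %% n < (j + n - i) %% n)%N]%SET.

End Polygon.

Section Cones.
Variables (R : realType) (I : finType) (V : lmodType R).

Definition cone (w : I -> V) (A : {set I}) : set V :=
  [set x | exists2 c : I -> R,
     (forall i, 0 <= c i) & x = \sum_(i in A) c i *: w i].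

End Cones.

Section Pfaffian.
Variables (R : realType) (n : nat).
Implicit Types (v : {ffun edge n -> R^o}) (T : {set edge n}).

Definition Pf1plus : set {ffun edge n -> R^o} :=
  [set v | forall (a a' b b' : 'I_n)
      (aa' : (a < a')%N) (a'b : (a' < b)%N) (bb' : (b < b')%N),
      let x : R := v (mkedge (ltn_trans aa' a'b)) + v (mkedge (ltn_trans a'b bb')) in
      let y : R := v (mkedge aa') + v (mkedge bb') in
      let z : R := v (mkedge (ltn_trans (ltn_trans aa' a'b) bb')) + v (mkedge a'b) in
      let m : R := Num.max x (Num.max y z) in
      (2 <= count_mem m [:: x; y; z])%N /\ x = m].

Definition W (i j : 'I_n) : {ffun edge n -> R^o} :=
  [ffun e => ((lo e \in cyc_interval i j) (+) (hi e \in cyc_interval i j))%:R].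

Definition Wdiag (e : edge n) : {ffun edge n -> R^o} := W (lo e) (hi e).

Definition lineality : {vspace {ffun edge n -> R^o}} :=
  <<[seq W i (ordS i) | i : 'I_n]>>%VS.

Definition Pf_cone T : set {ffun edge n -> R^o} :=
  [set v | exists l c, [/\ l \in lineality, cone Wdiag (diagonals T) c & v = l + c]].

Definition keep_coords T v : {ffun {e : edge n | e \in T} -> R^o} :=
  [ffun e => v (val e)].

End Pfaffian.

(* Polyhedral geometry in the coordinate space R^J, identified with its dual
   through the standard inner product. *)
Section Polyhedra.
Variables (R : realType) (J : finType).
Local Notation V := {ffun J -> R^o}.
Implicit Types (C D P F G : set V) (Fan : set (set V)) (u x y : V).

Definition dot u x : R := \sum_j (u j : R) * (x j : R).

Definition polyhedral_cone C : Prop :=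
  exists k (w : 'I_k -> V), C = cone w [set: 'I_k]%SET.

Definition simplicial_cone C : Prop :=
  exists k (w : 'I_k -> V),
    free [seq w i | i : 'I_k] /\ C = cone w [set: 'I_k]%SET.

Definition cone_face C D : Prop :=
  exists2 u, (forall x, C x -> 0 <= dot u x) & D = [set x | C x /\ dot u x = 0].

Definition is_fan Fan : Prop :=
  [/\ finite_set Fan,
      forall C, Fan C -> polyhedral_cone C,
      forall C D, Fan C -> cone_face C D -> Fan D &
      forall C D, Fan C -> Fan D -> cone_face C (C `&` D)].

Definition complete_fan Fan : Prop := forall x, exists2 C, Fan C & C x.

Definition simplicial_fan Fan : Prop := forall C, Fan C -> simplicial_cone C.

Definition max_cones Fan : set (set V) :=
  [set C | Fan C /\ forall D, Fan D -> C `<=` D -> D = C].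

Definition polytope P : Prop :=
  exists k (p : 'I_k -> V),
    P = [set x | exists2 c : 'I_k -> R,
           (forall i, 0 <= c i) /\ \sum_i c i = 1 & x = \sum_i c i *: p i].

(* The face of P with outer normal u. *)
Definition max_face P u : set V :=
  [set x | P x /\ forall y, P y -> dot u y <= dot u x].

(* For a nonempty polytope these are the nonempty faces, P itself (u = 0)
   included. *)
Definition face P F : Prop := exists u, F = max_face P u.

Definition normal_cone P F : set V :=
  [set u | forall x y, F x -> P y -> dot u y <= dot u x].

Definition normal_fan P : set (set V) :=
  [set C | exists2 F, face P F & C = normal_cone P F].

(* U is the linear subspace parallel to the affine hull of F. *)
Definition is_direction F (U : {vspace V}) : Prop :=
  (forall x y, F x -> F y -> x - y \in U) /\
  (forall U' : {vspace V},
     (forall x y, F x -> F y -> x - y \in U') -> (U <= U')%VS).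

Definition affine_dim F (d : nat) : Prop :=
  exists2 U, is_direction F U & \dim U = d.

Definition facet P F : Prop :=
  face P F /\ exists2 d, affine_dim P d.+1 & affine_dim F d.

Definition parallel F G : Prop :=
  exists2 U, is_direction F U & is_direction G U.

(* P is an (n-3)-dimensional associahedron: its nonempty faces are labelled
   bijectively by the dissections of the n-gon, and inclusion is reversed. *)
Definition realizes_associahedron n P (label : {set edge n} -> set V) : Prop :=
  [/\ affine_dim P (n - 3),
      forall S, dissection S -> face P (label S),
      forall F, face P F -> exists2 S, dissection S & F = label S &
      forall S S', dissection S -> dissection S' ->
        (label S' `<=` label S <-> S \subset S')].

Definition dissection_face n P (N : edge n -> V) (S : {set edge n}) : set V :=
  [set x | P x /\ forall e, e \in S -> max_face P (N e) x].

(* The unordered pairs of distinct diagonals e, f such that the faces of P with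
   outer normals N e, N f are parallel. *)
Definition parallel_pairs n P (N : edge n -> V) : {set {set edge n}} :=
  [set p | `[< exists e f, [/\ ~~ boundary e, ~~ boundary f, e != f,
                 p = [set e; f]%SET
               & parallel (max_face P (N e)) (max_face P (N f))] >]]%SET.

End Polyhedra.

(* Main.v *)
Require Import Defs.
From mathcomp Require Import all_boot all_order all_algebra.
From mathcomp Require Import boolp classical_sets functions cardinality reals.
From mathcomp Require Import zify ring lra.

Set Implicit Arguments.
Unset Strict Implicit.
Unset Printing Implicit Defensive.

Import Order.TTheory GRing.Theory Num.Theory.

Local Open Scope ring_scope.
Local Open Scope classical_set_scope.

(** Write s for the indicator of a cyclic interval; W_e is the split metric |s_a - s_b|, and its
    cross-ratio on a, b | c, d is -2 (s_a - s_b) (s_c - s_d), while cross-ratios vanish on L_n.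
    This gives three facts. Cross-ratios at two sides of the polygon read off the coefficients of
    a combination of the W_e. Combinations of non-crossing W_e satisfy the tropical Ptolemy
    relation, which determines a point of Pf_1^+ from its coordinates on T. And the cross-ratios
    on the quadrilaterals of T form a basis dual to the W_d, d in T, with values 0, 1, -1.

    If e and f cross, then W_e + W_f agrees on T with W_g + W_h for g, h two opposite sides of
    their quadrilateral, because edges of T joining the two pairs of opposite arcs would cross.
    The cost h(e), the number of pairs separated by W_e, strictly drops in this exchange, so a
    representation of a vector by rays of minimal cost is non-crossing: the fan is complete and h
    is strictly convex on it, and the polytope is the convex hull of the linear parts of h on the
    maximal cones. If f is the rotation of a diagonal e of T, the exchange reads
    W_e + W_f = 0 modulo L_n; conversely opposite rays must cross, and the exchange then forces
    g and h to be sides of the polygon. *)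

(** * Triangulations *)

Section Combinatorics.
Variable n : nat.
Implicit Types (e f g : edge n) (S T : {set edge n}).

(** The cross-ratio that isolates the coefficient of W_e uses coordinates outside T, so it does not
    survive the projection. Uniqueness of non-crossing representations in R^{n-3} is therefore
    proved upstairs: two points of Pf_1^+ with equal projections are shown, by the Ptolemy relation,
    to differ by an element of L_n, and only then are coefficients read off. The cross-ratios on
    quadrilaterals of T involve only edges of T, hence descend to the quotient.

    The exchange, by contrast, fails before projecting: its two sides differ by twice an indicator,
    and the seed decides which of the two resolutions is exact on T.

    Coefficients are real, so iterating the exchange gives no evident termination. The minimal cost
    is attained because only representations with independent support matter, and each support
    carries at most one. Minimal representations are non-crossing, hence unique, which gives strict
    convexity globally, without inspecting the walls of the fan.

    Parallel facets a priori have only proportional normals; the values 0, 1, -1 then force the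
    factor to be -1. *)

Lemma lo_lt_hi e : (lo e < hi e)%N.
Proof. exact: (valP e). Qed.

Lemma edge_eq e f : lo e = lo f :> nat -> hi e = hi f :> nat -> e = f.
Proof.
move=> lo_ef hi_ef; apply: val_inj.
case: e f lo_ef hi_ef => [[i j] ?] [[k l] ?] /=; rewrite /lo /hi /=.
by move=> /ord_inj -> /ord_inj ->.
Qed.

Lemma edge_of (i j : nat) : (i < j)%N -> (j < n)%N ->
  exists e, lo e = i :> nat /\ hi e = j :> nat.
Proof.
move=> lt_ij lt_jn; have lt_in := ltn_trans lt_ij lt_jn.
by exists (@mkedge n (Ordinal lt_in) (Ordinal lt_jn) lt_ij).
Qed.

Lemma crossC e f : cross e f = cross f e.
Proof. by rewrite /cross orbC. Qed.

Lemma crossee e : cross e e = false.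
Proof. by rewrite /cross; lia. Qed.

Lemma noncrossing_cross S e f : noncrossing S -> e \in S -> f \in S -> ~~ cross e f.
Proof. by move=> /forall_inP/(_ e) H eS fS; have /forall_inP/(_ f) := H eS; apply. Qed.

Lemma noncrossingP S :
  reflect (forall e f, e \in S -> f \in S -> ~~ cross e f) (noncrossing S).
Proof.
apply: (iffP idP) => [ncS e f|H]; first exact: noncrossing_cross.
by apply/forall_inP => e eS; apply/forall_inP => f fS; exact: H.
Qed.

Lemma noncrossing_sub S S' : S' \subset S -> noncrossing S -> noncrossing S'.
Proof.
move=> /fintype.subsetP sS /noncrossingP ncS; apply/noncrossingP => e f /sS eS /sS fS.
exact: ncS.
Qed.

Lemma triangulation_nc T e f :
  triangulation T -> e \in T -> f \in T -> ~~ cross e f.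
Proof. by move=> /maxsetP[ncT _]; exact: noncrossing_cross. Qed.

Lemma nested T e f : triangulation T -> e \in T -> f \in T ->
  (lo e < lo f)%N -> (lo f < hi e)%N -> (hi f <= hi e)%N.
Proof.
move=> triT eT fT lt1 lt2; rewrite leqNgt; apply: contra (triangulation_nc triT eT fT).
by rewrite /cross lt1 lt2 => ->.
Qed.

Lemma triangulationP T e : triangulation T ->
  (forall f, f \in T -> ~~ cross e f) -> e \in T.
Proof.
move=> /maxsetP[ncT maxT] He.
rewrite -(maxT (e |: T)%SET) ?setU11 ?finset.subsetUr //.
apply/noncrossingP => f g; rewrite !in_setU1.
move=> /orP[/eqP->|fT] /orP[/eqP->|gT]; rewrite ?crossee ?He //.
  by rewrite crossC He.
exact: noncrossing_cross ncT _ _.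
Qed.

Lemma triangulation_cross T e : triangulation T -> e \notin T ->
  exists2 f, f \in T & cross e f.
Proof.
move=> triT eT; apply: contrapT => H; move/negP: eT; apply.
apply: triangulationP => // f fT; apply/negP => ef; apply: H; by exists f.
Qed.

Lemma boundaryE e : boundary e = (hi e == (lo e).+1 :> nat)
   || (lo e == 0 :> nat) && (hi e == n.-1 :> nat).
Proof.
have := lo_lt_hi e; have := ltn_ord (hi e); rewrite /boundary -!val_eqE /=.
move: (nat_of_ord (lo e)) (nat_of_ord (hi e)) => i j ltjn ltij.
have -> : (i.+1 %% n)%N = i.+1 by rewrite modn_small //; lia.
congr (_ || _); have [->|neq] := eqVneq j n.-1.
  by rewrite prednK ?modnn ?andbT //; lia.
by rewrite modn_small; lia.
Qed.

Lemma boundary_cross e f : boundary e -> ~~ cross e f.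
Proof.
rewrite boundaryE /cross.
have := lo_lt_hi e; have := lo_lt_hi f; have := ltn_ord (hi e); have := ltn_ord (hi f).
lia.
Qed.

Lemma boundary_triangulation T e : triangulation T -> boundary e -> e \in T.
Proof. by move=> triT be; apply: triangulationP => // f _; exact: boundary_cross. Qed.

Lemma dissection_nc S : dissection S -> noncrossing S.
Proof. by case/andP. Qed.

Lemma dissection_nb S e : dissection S -> e \in S -> ~~ boundary e.
Proof. by case/andP => _ /forall_inP; apply. Qed.

Lemma dissection_sub S S' : S' \subset S -> dissection S -> dissection S'.
Proof.
move=> sS /andP[ncS /forall_inP nbS]; rewrite /dissection (noncrossing_sub sS) //=.
by apply/forall_inP => e /(fintype.subsetP sS); exact: nbS.
Qed.

Lemma diagonalsP T e : (e \in diagonals T) = (e \in T) && ~~ boundary e.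
Proof. by rewrite inE. Qed.

Lemma dissection_diagonals T : triangulation T -> dissection (diagonals T).
Proof.
move=> triT; apply/andP; split.
  apply/noncrossingP => e f; rewrite !diagonalsP => /andP[eT _] /andP[fT _].
  exact: triangulation_nc triT _ _.
by apply/forall_inP => e; rewrite diagonalsP => /andP[].
Qed.

Lemma dissection_ext S : dissection S ->
  exists2 T, triangulation T & S \subset diagonals T.
Proof.
move=> disS; have [T triT sST] := maxset_exists (dissection_nc disS).
exists T => //; apply/fintype.subsetP => e eS.
by rewrite diagonalsP (fintype.subsetP sST) // (dissection_nb disS).
Qed.

(** The apex is the far end of the longest edge of [T] that starts at [lo e] and ends before [hi e].
    An edge of [T] crossing the third side would cross [e] or [f], or be a longer such edge. *)
Lemma inner_triangle T e : triangulation T -> e \in T -> ((lo e).+1 < hi e)%N ->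
  exists f g, [/\ f \in T, g \in T, lo f = lo e :> nat, hi f = lo g :> nat
              & hi g = hi e :> nat].
Proof.
move=> triT eT le2; have ltn := ltn_ord (hi e).
have [f0 [lof0 hif0]] := edge_of (ltnSn (lo e)) (ltn_trans le2 ltn).
pose P f := [&& f \in T, lo f == lo e :> nat & (hi f < hi e)%N].
have Pf0 : P f0.
  by rewrite /P lof0 eqxx hif0 le2 boundary_triangulation // boundaryE lof0 hif0 eqxx.
have [f /and3P[fT /eqP lof hif] maxf] := arg_maxnP (fun f => nat_of_ord (hi f)) Pf0.
have [g [log hig]] := edge_of hif ltn.
exists f, g; split; rewrite ?lof ?log ?hig //.
apply: contrapT => /negP gT; have [k kT] := triangulation_cross triT gT.
have := triangulation_nc triT eT kT; have := triangulation_nc triT fT kT.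
have := lo_lt_hi f; have := lo_lt_hi k.
have := maxf k; rewrite /P kT /= lof /cross log hig; lia.
Qed.

(** Covers exist because the side joining the vertices 0 and n-1, here [f0], covers every edge and
    differs from the diagonal [e]. *)
Lemma minimal_cover T e : triangulation T -> e \in T -> ~~ boundary e ->
  exists f, [/\ f \in T, (lo f <= lo e)%N, (hi e <= hi f)%N, f != e &
     forall g, g \in T -> (lo g <= lo e)%N -> (hi e <= hi g)%N -> g != e ->
       (hi f - lo f <= hi g - lo g)%N].
Proof.
move=> triT eT nbe; have ltn := ltn_ord (hi e); have lte := lo_lt_hi e.
have n1 : (0 < n.-1)%N by lia. have n2 : (n.-1 < n)%N by lia.
have [f0 [lof0 hif0]] := edge_of n1 n2.
pose P f := [&& f \in T, (lo f <= lo e)%N, (hi e <= hi f)%N & f != e].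
have Pf0 : P f0.
  rewrite /P lof0 hif0 boundary_triangulation //=; last first.
    by rewrite boundaryE lof0 hif0 !eqxx orbT.
  apply/andP; split; first lia.
  by apply: contraNneq nbe => <-; rewrite boundaryE lof0 hif0 !eqxx orbT.
have [f /and4P[fT lof hif nef] minf] := arg_minnP (fun f => (hi f - lo f)%N) Pf0.
by exists f; split=> // g gT lg hg ge; apply: minf; rewrite /P gT lg hg ge.
Qed.

Lemma neq_edge e f : e != f -> lo e != lo f :> nat \/ hi e != hi f :> nat.
Proof.
move=> ef; have [l|] := eqVneq (lo e : nat) (lo f); last by left.
by right; apply: contraNneq ef => h; apply/eqP/edge_eq.
Qed.

(** The triangle beyond [e] is the inner triangle of the shortest edge of [T] strictly containing
    [e]: by minimality one of its two lower sides is [e]. The alternatives put the apex below [lo e]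
    or above [hi e]. *)
Lemma outer_triangle T e : triangulation T -> e \in T -> ~~ boundary e ->
  exists f g, [/\ f \in T, g \in T &
    [/\ lo f = lo g :> nat, hi f = lo e :> nat & hi g = hi e :> nat] \/
    [/\ lo f = hi e :> nat, lo g = lo e :> nat & hi f = hi g :> nat]].
Proof.
move=> triT eT nbe; have lte := lo_lt_hi e.
have [k [kT lok hik /neq_edge nke mink]] := minimal_cover triT eT nbe.
have [|f [g [fT gT lof fg hig]]] := inner_triangle triT kT; first by lia.
have := triangulation_nc triT eT fT; have := triangulation_nc triT eT gT.
have := lo_lt_hi f; have := lo_lt_hi g; rewrite /cross => ltf ltg nc1 nc2.
have [ge|nge] := eqVneq g e.
  by exists f, k; split=> //; left; rewrite lof -hig fg ge.
have [fe|nfe] := eqVneq f e.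
  by exists g, k; split=> //; right; rewrite -fg hig -lof fe.
have := mink f fT; have := mink g gT; rewrite nge nfe; lia.
Qed.

(** Count by apexes: [D] consists of the diagonals and the side {0, n-1}, and sending an edge of [D]
    to the apex of its inner triangle is a bijection onto the n-2 vertices other than 0 and n-1. *)
Lemma card_diagonals T : (4 <= n)%N -> triangulation T -> #|diagonals T| = (n - 3)%N.
Proof.
move=> n4 triT.
pose D := [set e in T | ((lo e).+1 < hi e)%N].
have n1 : (0 < n.-1)%N by lia. have n2 : (n.-1 < n)%N by lia.
have [f0 [lof0 hif0]] := edge_of n1 n2.
have f0T : f0 \in T by rewrite boundary_triangulation // boundaryE lof0 hif0 !eqxx orbT.
have DE : D = (f0 |: diagonals T)%SET.
  apply/setP => e; rewrite !inE boundaryE.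
  have := lo_lt_hi e; have := ltn_ord (hi e).
  have [->|/neq_edge] := eqVneq e f0; rewrite ?f0T ?lof0 ?hif0; case: (e \in T); lia.
have f0D : f0 \notin diagonals T.
  by rewrite inE boundaryE lof0 hif0 !eqxx orbT andbF.
have cardD : #|D| = (#|diagonals T|).+1 by rewrite DE cardsU1 f0D.
have midP e : {k : 'I_n | e \in D -> exists f g,
    [/\ f \in T, g \in T, lo f = lo e :> nat, hi f = k & lo g = k /\ hi g = hi e :> nat]}.
  apply: cid; case: (boolP (e \in D)) => [|_]; last by exists (lo e).
  rewrite inE => /andP[eT le2].
  have [f [g [fT gT lof fg hig]]] := inner_triangle triT eT le2.
  by exists (hi f) => _; exists f, g; split=> //; split=> //; apply: ord_inj.
pose mid e := sval (midP e).
have mid_inj : {in D &, injective mid}.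
  move=> e e' eD e'D mee'.
  have [f [g [fT gT lof hif [log hig]]]] := svalP (midP e) eD.
  have [f' [g' [f'T g'T lof' hif' [log' hig']]]] := svalP (midP e') e'D.
  have eT : e \in T by move: eD; rewrite inE => /andP[].
  have e'T : e' \in T by move: e'D; rewrite inE => /andP[].
  have := lo_lt_hi f; have := lo_lt_hi g; have := lo_lt_hi f'; have := lo_lt_hi g'.
  have := nested triT fT e'T; have := nested triT f'T eT.
  have := nested triT eT g'T; have := nested triT e'T gT.
  rewrite lof hif log hig lof' hif' log' hig' -/(mid e) -/(mid e') mee' => N1 N2 N3 N4 l1 l2 l3 l4.
  apply: edge_eq; apply/eqP; rewrite eqn_leq.
    by apply/andP; split; rewrite leqNgt; apply/negP => lt; [have := N3 lt l4|have := N4 lt l2];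
      rewrite leqNgt ?l1 ?l3.
  by apply/andP; split; rewrite leqNgt; apply/negP => lt; [have := N1 l2 l1|have := N2 l4 l3];
    rewrite leqNgt lt.
have midD : [set mid e | e in D]%SET = [set k : 'I_n | (0 < k < n.-1)%N]%SET.
  apply/setP => k; rewrite inE; apply/imsetP/idP => [[e eD ->]|k_int].
    have [f [g [fT gT lof hif [log hig]]]] := svalP (midP e) eD.
    have := lo_lt_hi f; have := lo_lt_hi g; have := ltn_ord (hi g).
    rewrite hif log -/(mid e); lia.
  (* The shortest edge of [T] straddling [k] has apex [k], since otherwise a side of its triangle
     would straddle [k] as well. *)
  pose P e := [&& e \in T, (lo e < k)%N & (k < hi e)%N].
  have Pf0 : P f0 by rewrite /P f0T lof0 hif0.
  have [e /and3P[eT loe hie] mine] := arg_minnP (fun f => (hi f - lo f)%N) Pf0.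
  have eD : e \in D by rewrite inE eT; lia.
  exists e => //; have [f [g [fT gT lof hif [log hig]]]] := svalP (midP e) eD.
  have := mine f; have := mine g; rewrite /P fT gT lof hif log hig -/(mid e).
  have := lo_lt_hi f; have := lo_lt_hi g; rewrite lof hif log hig -/(mid e) => ? ? ? ?.
  by apply: ord_inj; lia.
have : #|D| = (n - 2)%N; last by lia.
rewrite -(card_in_imset mid_inj) midD.
have -> : [set k : 'I_n | (0 < k < n.-1)%N]%SET = (~: [set lo f0; hi f0])%SET.
  apply/setP => k; rewrite !inE -!val_eqE /= lof0 hif0; have := ltn_ord k; lia.
rewrite cardsCs finset.setCK card_ord cards2 -val_eqE /= lof0 hif0; lia.
Qed.

(** [f] is the other diagonal of the quadrilateral formed by the two triangles of [T] at [e]. An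
    edge that crosses [f] but no side of this quadrilateral and not [e] must have the ends of
    [e]. *)
Lemma flip_edge T e : triangulation T -> e \in T -> ~~ boundary e ->
  exists f, [/\ cross e f, ~~ boundary f &
    forall g, g \in T -> g != e -> ~~ cross f g].
Proof.
move=> triT eT nbe; have := nbe; rewrite boundaryE => nbe'.
have lte := lo_lt_hi e.
have [|f1 [g1 [f1T g1T lof1 fg1 hig1]]] := inner_triangle triT eT; first by lia.
have [f2 [g2 [f2T g2T quad2]]] := outer_triangle triT eT nbe.
have [f [cef fP]] : exists f, cross e f /\ forall g, g \in T -> g != e -> ~~ cross f g.
  have h1 := lo_lt_hi f1; have h2 := lo_lt_hi g1.
  have h3 := lo_lt_hi f2; have h4 := lo_lt_hi g2.
  case: quad2 => [[lfg hf hg]|[lf lg hfg]].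
    have [|f [lof hif]] := @edge_of (lo f2) (hi f1) _ (ltn_ord _); first by lia.
    exists f; split=> [|g gT nge].
      by rewrite /cross lof hif; clear - lte h1 h2 h3 h4 lof1 fg1 hig1 lfg hf hg; lia.
    have N1 := nested triT gT g2T; have N2 := nested triT f1T gT.
    have N3 := nested triT f2T gT; have N4 := nested triT g2T gT.
    have N5 := nested triT gT g1T.
    have g_e : lo g = lo e :> nat -> hi g = hi e :> nat -> False.
      by move=> lo_ge hi_ge; move/eqP: nge; apply; apply: edge_eq.
    apply/negP; rewrite /cross lof hif.
    clear - lte h1 h2 h3 h4 lof1 fg1 hig1 lfg hf hg N1 N2 N3 N4 N5 g_e.
    move=> /orP[] /and3P[lt1 lt2 lt3]; last by clear N2 N3 N4 N5; lia.
    have le_ga : (lo g <= lo e)%N by clear N1 N3 N4 N5; lia.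
    have le_ag : (lo e <= lo g)%N by clear N1 N2 N4 N5; lia.
    have le_gb : (hi g <= hi e)%N by clear N1 N2 N3 N5; lia.
    have le_bg : (hi e <= hi g)%N by clear N1 N2 N3 N4; lia.
    by apply: g_e; apply/eqP; rewrite eqn_leq ?le_ga ?le_gb.
  have [|f [lof hif]] := @edge_of (hi f1) (hi f2) _ (ltn_ord _).
    by clear - lte h1 h2 h3 h4 lof1 fg1 hig1 lf lg hfg; lia.
  exists f; split=> [|g gT nge].
    by rewrite /cross lof hif; clear - lte h1 h2 h3 h4 lof1 fg1 hig1 lf lg hfg; lia.
  have N1 := nested triT g2T gT; have N2 := nested triT f1T gT.
  have N3 := nested triT gT g2T; have N4 := nested triT gT g1T.
  have N5 := nested triT gT f2T.
  have g_e : lo g = lo e :> nat -> hi g = hi e :> nat -> False.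
    by move=> lo_ge hi_ge; move/eqP: nge; apply; apply: edge_eq.
  apply/negP; rewrite /cross lof hif.
  clear - lte h1 h2 h3 h4 lof1 fg1 hig1 lf lg hfg N1 N2 N3 N4 N5 g_e.
  move=> /orP[] /and3P[lt1 lt2 lt3]; first by clear N2 N3 N4 N5; lia.
  have le_ga : (lo g <= lo e)%N by clear N1 N3 N4 N5; lia.
  have le_ag : (lo e <= lo g)%N by clear N1 N2 N4 N5; lia.
  have le_bg : (hi e <= hi g)%N by clear N1 N2 N3 N5; lia.
  have le_gb : (hi g <= hi e)%N by clear N1 N2 N3 N4; lia.
  by apply: g_e; apply/eqP; rewrite eqn_leq ?le_ga ?le_gb.
exists f; split=> //; apply/negP => bf; move/negP: (boundary_cross e bf); apply.
by rewrite crossC.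
Qed.

Lemma flip T e : triangulation T -> e \in diagonals T ->
  exists T', [/\ triangulation T', diagonals T :\ e \subset diagonals T'
               & e \notin diagonals T'].
Proof.
move=> triT; rewrite diagonalsP => /andP[eT nbe].
have [f [cef nbf fP]] := flip_edge triT eT nbe.
have dis : dissection (f |: (diagonals T :\ e))%SET.
  apply/andP; split.
    apply/noncrossingP => g h; rewrite !inE.
    move=> /orP[/eqP->|/and3P[ge gT _]] /orP[/eqP->|/and3P[he hT _]]; rewrite ?crossee ?fP //.
      by rewrite crossC fP.
    exact: triangulation_nc triT _ _.
  by apply/forall_inP => g; rewrite !inE => /orP[/eqP->|/and3P[]].
have [T' triT' sT'] := dissection_ext dis; exists T'; split=> //.
  by apply: fintype.subset_trans sT'; rewrite finset.subsetUr.
rewrite diagonalsP; apply: contraL cef => /andP[eT' _].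
apply: triangulation_nc triT' _ _ => //.
have : f \in diagonals T' by rewrite (fintype.subsetP sT') // setU11.
by rewrite diagonalsP => /andP[].
Qed.

(** If [hi e] is n-1 it wraps around to 0 and the two ends exchange their order. *)
Lemma rotateE e :
  (hi e < n.-1)%N /\ lo (rotate e) = (lo e).+1 :> nat /\ hi (rotate e) = (hi e).+1 :> nat
  \/ hi e = n.-1 :> nat /\ lo (rotate e) = 0%N :> nat /\ hi (rotate e) = (lo e).+1 :> nat.
Proof.
have lte := lo_lt_hi e; have ltn := ltn_ord (hi e).
have lo1 : ((lo e).+1 %% n = (lo e).+1)%N by rewrite modn_small; lia.
have [hn|hn] := eqVneq (hi e : nat) n.-1.
  right; have h1 : ((hi e).+1 %% n = 0)%N by rewrite hn prednK ?modnn; lia.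
  by rewrite /rotate /lo /hi /= -/(lo e) -/(hi e) lo1 h1 /= lo1 h1.
left; have h1 : ((hi e).+1 %% n = (hi e).+1)%N by rewrite modn_small; lia.
have lt1 : ((lo e).+1 < (hi e).+1)%N by lia.
rewrite /rotate /lo /hi /= -/(lo e) -/(hi e) lo1 h1 lt1 /= lo1 h1; lia.
Qed.

Lemma cross_rotate e : ~~ boundary e -> cross e (rotate e).
Proof.
rewrite boundaryE /cross; have := lo_lt_hi e; have := ltn_ord (hi e).
case: (rotateE e) => [] [? [-> ->]]; lia.
Qed.

Lemma rotate_nb e : ~~ boundary e -> ~~ boundary (rotate e).
Proof.
move=> nbe; apply/negP => /(fun b => boundary_cross e b).
by rewrite crossC cross_rotate.
Qed.

(* The termination measure when the tropical Ptolemy relation is used to recover a point of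
   Pf_1^+ from its coordinates on T. *)
Lemma crossings_lt T e f g : triangulation T -> f \in T -> cross e f ->
  (lo g = lo e :> nat \/ lo g = hi e :> nat \/ hi g = lo e :> nat \/ hi g = hi e :> nat) ->
  (lo g = lo f :> nat \/ lo g = hi f :> nat \/ hi g = lo f :> nat \/ hi g = hi f :> nat) ->
  (#|[set k in T | cross g k]%SET| < #|[set k in T | cross e k]%SET|)%N.
Proof.
move=> triT fT cef ge gf; apply: proper_card; apply/fintype.properP; split.
  apply/fintype.subsetP => k; rewrite !inE => /andP[kT]; rewrite kT /=.
  have := nested triT fT kT; have := nested triT kT fT.
  have := lo_lt_hi e; have := lo_lt_hi f; have := lo_lt_hi g; have := lo_lt_hi k.
  rewrite /cross => ? ? ? ? ? ? /orP[] /and3P[] ? ? ?; move: cef ge gf;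
    rewrite /cross => /orP[] /and3P[] ? ? ? [|[|[|]]] ? [|[|[|]]] ?; lia.
exists f; rewrite !inE ?fT //=.
have := lo_lt_hi e; have := lo_lt_hi f; have := lo_lt_hi g.
move: cef ge gf; rewrite /cross; lia.
Qed.

End Combinatorics.

(** * Split metrics *)

Section Splits.
Variable n : nat.
Implicit Types (e f g : edge n) (S T : {set edge n}) (x y : 'I_n).

Definition side e (x : nat) : bool := (lo e <= x < hi e)%N.

Lemma mem_cyc_interval (i j k : 'I_n) : (i < j)%N ->
  (k \in cyc_interval i j) = (i <= k < j)%N.
Proof.
move=> lt_ij; rewrite inE; have := ltn_ord k; have := ltn_ord j.
move: lt_ij; case: i j k => [i ?] [j ?] [k ?] /= lt_ij ltj ltk.
have -> : ((j + n - i) %% n = j - i)%N.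
  have -> : (j + n - i = (j - i) + n)%N by lia.
  by rewrite modnDr modn_small //; lia.
have [le_ik|lt_ki] := leqP i k.
  have -> : (k + n - i = (k - i) + n)%N by lia.
  by rewrite modnDr modn_small //; lia.
by rewrite modn_small; lia.
Qed.

Lemma mem_cyc_interval1 (i k : 'I_n) : (1 < n)%N ->
  (k \in cyc_interval i (ordS i)) = (k == i).
Proof.
move=> n1; rewrite inE -val_eqE /=; have := ltn_ord k; have := ltn_ord i.
move: (nat_of_ord i) (nat_of_ord k) => {}i {}k lti ltk.
have -> : ((i.+1 %% n + n - i) %% n = 1)%N.
  have [lt|ge] := ltnP i.+1 n.
    rewrite (modn_small lt); have -> : (i.+1 + n - i = 1 + n)%N by lia.
    by rewrite modnDr modn_small.
  have -> : i = n.-1 by lia.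
  rewrite prednK ?modnn; last lia.
  by have -> : (0 + n - n.-1 = 1)%N; [lia | rewrite modn_small].
have [le_ik|lt_ki] := leqP i k.
  have -> : (k + n - i = (k - i) + n)%N by lia.
  by rewrite modnDr modn_small //; lia.
by rewrite modn_small; lia.
Qed.

End Splits.

(** * Distances, cross-ratios and the lineality space *)

Section Metrics.
Variables (R : realType) (n : nat).
Implicit Types (e f g : edge n) (S T : {set edge n}) (x y : 'I_n).
Local Notation V := {ffun edge n -> R^o}.
Local Notation L := (lineality R n).
Local Notation Wd := (@Wdiag R n).
Implicit Types (u v w : V).

Lemma WdiagE e p : Wd e p = (side e (lo p) (+) side e (hi p))%:R.
Proof. by rewrite /Wdiag /W ffunE !mem_cyc_interval ?lo_lt_hi. Qed.

(** The symmetric extension of [v] to ordered pairs of vertices, with default value 0 on the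
    diagonal. *)
Definition dist v x y : R :=
  if insub (x, y) is Some e then v (e : edge n)
  else if insub (y, x) is Some e then v e else 0.

Lemma dist_lt v x y (lt_xy : (x < y)%N) : dist v x y = v (mkedge lt_xy).
Proof.
rewrite /dist; case: insubP => [e _ val_e|]; last by rewrite /= lt_xy.
by congr (v _); apply: val_inj.
Qed.

Lemma distC v x y : dist v x y = dist v y x.
Proof.
rewrite /dist; case: insubP => [e e1 val_e|]; case: insubP => [f f1 val_f|] //.
by move: e1 f1; rewrite /=; lia.
Qed.

Lemma dist_edge v e : dist v (lo e) (hi e) = v e.
Proof. by rewrite (dist_lt _ (lo_lt_hi e)); congr (v _); apply: edge_eq. Qed.

Lemma distE x y : x != y :> nat -> exists e,
  (lo e = x /\ hi e = y \/ lo e = y /\ hi e = x) /\ forall v, dist v x y = v e.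
Proof.
case: ltngtP => // lt _.
  by exists (mkedge lt); split=> [|v]; [left|rewrite (dist_lt _ lt)].
by exists (mkedge lt); split=> [|v]; [right|rewrite distC (dist_lt _ lt)].
Qed.

Lemma dist_W e x y : x != y :> nat -> dist (Wd e) x y = (side e x (+) side e y)%:R.
Proof.
by move=> /distE[f [[[<- <-]|[<- <-]] ->]]; rewrite WdiagE // addbC.
Qed.

Definition crossratio v (a b c d : 'I_n) : R :=
  dist v a c + dist v b d - dist v a d - dist v b c.

(** Keeps the four pairs of a cross-ratio off the diagonal, where the default value of [dist] would
    spoil the cancellation on [L]. *)
Definition apart (a b c d : 'I_n) :=
  [&& a != c :> nat, b != d :> nat, a != d :> nat & b != c :> nat].

(** For indicators, |s - t| = s + t - 2st; the linear terms cancel in the cross-ratio and the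
    products factor. *)
Lemma crossratio_W e a b c d : apart a b c d ->
  crossratio (Wd e) a b c d =
  - 2 * ((side e a)%:R - (side e b)%:R) * ((side e c)%:R - (side e d)%:R).
Proof.
case/and4P=> *; rewrite /crossratio !dist_W //.
by case: (side e a) (side e b) (side e c) (side e d) => [] [] [] [] /=; ring.
Qed.

Lemma dist_lin (I : finType) (c : I -> R) (F : I -> V) x y : x != y :> nat ->
  dist (\sum_i c i *: F i) x y = \sum_i c i * dist (F i) x y.
Proof.
move=> /distE[e [_ H]]; rewrite H sum_ffunE.
by apply: eq_bigr => i _; rewrite ffunE H.
Qed.

Lemma crossratio_lin (I : finType) (c : I -> R) (F : I -> V) a b d z : apart a b d z ->
  crossratio (\sum_i c i *: F i) a b d z = \sum_i c i * crossratio (F i) a b d z.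
Proof.
case/and4P=> *; rewrite /crossratio !dist_lin // -big_split /= -!sumrB.
by apply: eq_bigr => i _; ring.
Qed.

Lemma distD v w x y : x != y :> nat -> dist (v + w) x y = dist v x y + dist w x y.
Proof. by move=> /distE[e [_ H]]; rewrite !H ffunE. Qed.

Lemma crossratioD v w a b d z : apart a b d z ->
  crossratio (v + w) a b d z = crossratio v a b d z + crossratio w a b d z.
Proof. by case/and4P=> *; rewrite /crossratio !distD //; ring. Qed.

(* The condition defining Pf_1^+ is the tropical Ptolemy relation. *)
Lemma Pf1plusP v : Pf1plus v <-> forall a a' b b' : 'I_n,
  (a < a')%N -> (a' < b)%N -> (b < b')%N ->
  dist v a b + dist v a' b' =
  Num.max (dist v a a' + dist v b b') (dist v a b' + dist v a' b).
Proof.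
have H (x y z : R) : (2 <= count_mem (Num.max x (Num.max y z)) [:: x; y; z])%N /\
    x = Num.max x (Num.max y z) <-> x = Num.max y z.
  split=> [[]|] /=; last first.
    move=> E; rewrite -E maxxx eqxx; split=> //.
    by rewrite E; case: leP => _; rewrite eqxx; lia.
  move=> cnt E; rewrite -E eqxx in cnt.
  have le_m : Num.max y z <= x by rewrite E le_max lexx orbT.
  apply/eqP; rewrite eq_le le_m andbT le_max.
  by case: (y =P x) cnt => [->|_]; case: (z =P x) => [->|_]; rewrite ?lexx ?orbT.
split=> vP a a' b b' aa' a'b bb'.
  have /H := vP a a' b b' aa' a'b bb'.
  by rewrite -!dist_lt.
by rewrite /= -!dist_lt; apply/H/vP.
Qed.

Hypothesis n_ge4 : (4 <= n)%N.

Lemma W1E (i : 'I_n) p : W R i (ordS i) p = (lo p == i)%:R + (hi p == i)%:R.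
Proof.
rewrite /W ffunE !mem_cyc_interval1; try lia.
have := lo_lt_hi p; case: eqP => [->|_]; case: eqP => [->|_] //=; rewrite ?addr0 ?add0r //.
by rewrite ltnn.
Qed.

Lemma lineality_star (i : 'I_n) : W R i (ordS i) \in L.
Proof. by apply/memv_span/map_f; rewrite mem_enum. Qed.

(** W_{i,i+1} is the star metric at the vertex i, so [L] consists of the sums of vertex potentials
    [t]. *)
Lemma linealityP v : reflect (exists t : 'I_n -> R, forall p, v p = t (lo p) + t (hi p))
  (v \in L).
Proof.
apply: (iffP idP) => [|[t vt]].
  pose s := [seq W R i (ordS i) | i : 'I_n].
  have kP (i : 'I_(size s)) : {k : 'I_n | s`_i = W R k (ordS k)}.
    by apply: cid; have /mapP[k _ ->] := mem_nth 0 (ltn_ord i); exists k.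
  move=> /(coord_span (X := in_tuple s)) ->.
  exists (fun x => \sum_i coord (in_tuple s) i v * (x == sval (kP i))%:R) => p.
  rewrite sum_ffunE -big_split /=; apply: eq_bigr => i _.
  by rewrite ffunE; case: (kP i) => k /= ->; rewrite W1E -mulrDr.
have -> : v = \sum_i t i *: W R i (ordS i).
  apply/ffunP => p; rewrite vt sum_ffunE.
  under eq_bigr do rewrite ffunE W1E /GRing.scale /= mulrDr.
  rewrite big_split /= (bigD1 (lo p)) //= eqxx mulr1 big1 ?addr0; last first.
    by move=> i ne; rewrite eq_sym (negPf ne) mulr0.
  rewrite (bigD1 (hi p)) //= eqxx mulr1 big1 ?addr0 // => i ne.
  by rewrite eq_sym (negPf ne) mulr0.
by apply: memv_suml => i _; rewrite memvZ ?lineality_star.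
Qed.

Lemma crossratio_L v a b c d : v \in L -> apart a b c d -> crossratio v a b c d = 0.
Proof.
move=> /linealityP[t vt] /and4P[ac bd ad bc].
have H x y : x != y :> nat -> dist v x y = t x + t y.
  by move=> /distE[f [[[<- <-]|[<- <-]] ->]]; rewrite vt // addrC.
by rewrite /crossratio !H //; ring.
Qed.

(** An interval that cuts the four vertices two against two does so as aa' | bb' ([p1]) or ab' | a'b
    ([p2]), never as ab | a'b' ([alt]). The two cross-ratios are twice the total coefficients of
    these types, hence nonnegative. Edges of different types cross, so one of the two vanishes,
    which is the Ptolemy relation. *)
Lemma noncrossing_combination_Pf l (c : edge n -> R) : l \in L ->
  (forall e, 0 <= c e) -> (forall e f, c e != 0 -> c f != 0 -> ~~ cross e f) ->
  Pf1plus (l + \sum_e c e *: Wd e).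
Proof.
move=> lL c0 ncc; apply/Pf1plusP => a a' b b' aa' a'b bb'.
set v := l + _.
pose p1 e := [&& side e a == side e a', side e b == side e b' & side e a != side e b].
pose p2 e := [&& side e a == side e b', side e a' == side e b & side e a != side e a'].
have ap1 : apart a b' b a' by rewrite /apart; lia.
have ap2 : apart a a' b b' by rewrite /apart; lia.
have alt e : ~~ [&& side e a, ~~ side e a', side e b & ~~ side e b'] &&
             ~~ [&& ~~ side e a, side e a', ~~ side e b & side e b'].
  by rewrite /side; lia.
have X1 : crossratio v a b' b a' = \sum_e c e * (2 * (p1 e)%:R).
  rewrite crossratioD // (crossratio_L lL ap1) add0r crossratio_lin //.
  apply: eq_bigr => e _; rewrite crossratio_W // /p1; congr (_ * _); move: (alt e).
  by case: (side e a) (side e a') (side e b) (side e b') => [] [] [] [] //= _; ring.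
have X2 : crossratio v a a' b b' = \sum_e c e * (2 * (p2 e)%:R).
  rewrite crossratioD // (crossratio_L lL ap2) add0r crossratio_lin //.
  apply: eq_bigr => e _; rewrite crossratio_W // /p2; congr (_ * _); move: (alt e).
  by case: (side e a) (side e a') (side e b) (side e b') => [] [] [] [] //= _; ring.
have X10 : 0 <= crossratio v a b' b a'.
  by rewrite X1; apply: sumr_ge0 => e _; rewrite !mulr_ge0.
have X20 : 0 <= crossratio v a a' b b'.
  by rewrite X2; apply: sumr_ge0 => e _; rewrite !mulr_ge0.
have [[e ce p2e]|no2] := pselect (exists2 e, c e != 0 & p2 e).
  have : crossratio v a b' b a' = 0.
    rewrite X1 big1 // => f _; have [->|cf] := eqVneq (c f) 0; first by rewrite mul0r.
    case p1f : (p1 f); rewrite ?mulr0 //; have := ncc _ _ ce cf; move: p1f p2e.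
    by rewrite /p1 /p2 /side /cross; lia.
  move: X20; rewrite /crossratio [dist v b' b]distC [dist v b' a']distC.
  by move=> ? ?; rewrite maxElt; case: ltP; lra.
have : crossratio v a a' b b' = 0.
  rewrite X2 big1 // => f _; have [->|cf] := eqVneq (c f) 0; first by rewrite mul0r.
  by case p2f : (p2 f); rewrite ?mulr0 //; case: no2; exists f.
move: X10; rewrite /crossratio [dist v b' b]distC [dist v b' a']distC.
by move=> ? ?; rewrite maxElt; case: ltP; lra.
Qed.

End Metrics.

(** * The exchange relation *)

Section Modulo.
Variables (R : realType) (n : nat).
Hypothesis n_ge4 : (4 <= n)%N.
Implicit Types (e f g : edge n) (S T : {set edge n}) (x y : 'I_n).
Local Notation V := {ffun edge n -> R^o}.
Local Notation L := (lineality R n).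
Local Notation Wd := (@Wdiag R n).
Implicit Types (u v w : V).

(** [e] and an edge [f] of [T] crossing it occur together on the side of the Ptolemy relation that
    attains the maximum. So the coordinate at [e] is solved from the one at [f] and the four sides,
    each of which crosses fewer edges of [T] than [e]. *)
Lemma Pf_ext T v w : triangulation T -> Pf1plus v -> Pf1plus w ->
  (forall e, e \in T -> v e = w e) -> v = w.
Proof.
move=> triT /Pf1plusP vP /Pf1plusP wP vw; apply/ffunP => e.
have [m] := ubnP #|[set k in T | cross e k]%SET|.
elim: m e => // m IH e; rewrite ltnS => lt_m; have [/vw //|eT] := boolP (e \in T).
have [f fT cef] := triangulation_cross triT eT.
have sides x y : x = lo e \/ x = hi e -> y = lo f \/ y = hi f -> x != y :> nat ->
    dist v x y = dist w x y.
  move=> xe yf /distE-/(_ R)[g [gxy H]]; rewrite !H; apply: IH.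
  apply: leq_trans lt_m; apply: (crossings_lt triT fT cef).
    by case: xe gxy => -> [] [-> ->]; tauto.
  by case: yf gxy => -> [] [-> ->]; tauto.
have vwf := vw f fT.
move: cef; rewrite /cross => /orP[] /and3P[lt1 lt2 lt3].
  have := vP _ _ _ _ lt1 lt2 lt3; have := wP _ _ _ _ lt1 lt2 lt3.
  rewrite !dist_edge [dist v (lo f) (hi e)]distC [dist w (lo f) (hi e)]distC.
  rewrite !(sides (lo e)) ?(sides (hi e)); try tauto; try lia.
  by rewrite vwf => <- /addIr.
have := vP _ _ _ _ lt1 lt2 lt3; have := wP _ _ _ _ lt1 lt2 lt3.
rewrite !dist_edge ![dist _ (lo f) _]distC ![dist _ (hi f) (hi e)]distC.
rewrite (sides (lo e) (lo f)) ?(sides (lo e) (hi f)) ?(sides (hi e)) //; try tauto; try lia.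
by rewrite vwf => <- /addrI.
Qed.

(** Equality after the projection to the seed, expressed through the kernel of phi rather than phi
    itself. *)
Definition eqmod T v w := exists2 l, l \in L & forall e, e \in T -> v e = w e + l e.

Lemma Pf_addL v l : Pf1plus v -> l \in L -> Pf1plus (v + l).
Proof.
move=> /Pf1plusP vP lL; apply/Pf1plusP => a a' b b' aa' a'b bb'.
have ap1 : apart a b' b a' by rewrite /apart; lia.
have ap2 : apart a a' b b' by rewrite /apart; lia.
have := crossratio_L n_ge4 lL ap1; have := crossratio_L n_ge4 lL ap2; have := vP _ _ _ _ aa' a'b bb'.
rewrite /crossratio [dist l b' b]distC [dist l b' a']distC !distD; try lia.
by rewrite !maxElt; case: ltP => ?; case: ltP => ?; lra.
Qed.

Lemma Pf_eqmod T v w : triangulation T -> Pf1plus v -> Pf1plus w -> eqmod T v w ->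
  v - w \in L.
Proof.
move=> triT vP wP [l lL H]; have -> : v = w + l.
  by apply: (Pf_ext triT vP (Pf_addL wP lL)) => e eT; rewrite H // ffunE.
by rewrite addrC addKr.
Qed.

(* The second difference of v at the sides lo e and hi e recovers the coefficient of W_e. *)
Lemma isolate e : ~~ boundary e -> exists a b c d : 'I_n, apart a b c d /\
  forall f, crossratio (Wd f) a b c d = 2 * (f == e)%:R.
Proof.
rewrite boundaryE => nbe; have lte := lo_lt_hi e; have ltn := ltn_ord (hi e).
(* The predecessors of [lo e] and [hi e] complete the two cut sides; only the first can wrap around,
   as [hi e] is positive. *)
pose i' := if (lo e == 0 :> nat)%N then n.-1 else (lo e).-1.
have lti' : (i' < n)%N by rewrite /i'; case: (nat_of_ord (lo e) =P 0%N); lia.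
have ltj' : ((hi e).-1 < n)%N by lia.
have ap : apart (Ordinal lti') (lo e) (Ordinal ltj') (hi e).
  by rewrite /apart /= /i'; case: (nat_of_ord (lo e) =P 0%N); lia.
exists (Ordinal lti'), (lo e), (Ordinal ltj'), (hi e); split=> // f.
rewrite crossratio_W //=.
have [->|nef] := eqVneq f e.
  have -> : side e i' = false by rewrite /side /i'; case: (nat_of_ord (lo e) =P 0%N); lia.
  have -> : side e (lo e) by rewrite /side; lia.
  have -> : side e (hi e).-1 by rewrite /side; lia.
  have -> : side e (hi e) = false by rewrite /side; lia.
  by rewrite /=; ring.
(* Another edge with nonzero value would change sides at both cuts, so its ends would be those of
   [e]. *)
have [->|ne1] := eqVneq (side f i') (side f (lo e)); first by rewrite subrr mulr0 mul0r mulr0.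
have [->|ne2] := eqVneq (side f (hi e).-1) (side f (hi e)); first by rewrite subrr mulr0 mulr0.
exfalso; have ltf := lo_lt_hi f; have ltfn := ltn_ord (hi f).
have h1 : (lo e == lo f :> nat) || (lo e == hi f :> nat).
  by move: ne1; rewrite /side /i'; case: (nat_of_ord (lo e) =P 0%N); lia.
have h2 : (hi e == lo f :> nat) || (hi e == hi f :> nat).
  by move: ne2; rewrite /side; lia.
by move/eqP: nef; apply; apply: edge_eq; lia.
Qed.

Lemma sum_W_L (c : edge n -> R) e : ~~ boundary e -> \sum_f c f *: Wd f \in L -> c e = 0.
Proof.
move=> /isolate[a [b [d [z [ap H]]]]] /(crossratio_L n_ge4)/(_ ap).
rewrite crossratio_lin // (bigD1 e) //= H eqxx big1 => [|f ne]; first by rewrite /= => ?; lra.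
by rewrite H (negPf ne) !mulr0.
Qed.

Lemma dissection_combination_Pf l S (c : edge n -> R) : l \in L -> dissection S ->
  (forall e, 0 <= c e) -> (forall e, e \notin S -> c e = 0) ->
  Pf1plus (l + \sum_e c e *: Wd e).
Proof.
move=> lL disS c0 cS; apply: noncrossing_combination_Pf => // f g cf cg.
apply: noncrossing_cross (dissection_nc disS) _ _.
  by apply: contraNT cf => /cS ->.
by apply: contraNT cg => /cS ->.
Qed.

(** Both combinations lie in Pf_1^+, so agreement modulo [L] on [T] extends to all coordinates; then
    the coefficients at diagonals are compared by [sum_W_L], and those at sides of the polygon
    vanish. *)
Lemma combination_uniq T (S S' : {set edge n}) (c c' : edge n -> R) :
  triangulation T -> dissection S -> dissection S' ->
  (forall e, 0 <= c e) -> (forall e, 0 <= c' e) ->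
  (forall e, e \notin S -> c e = 0) -> (forall e, e \notin S' -> c' e = 0) ->
  eqmod T (\sum_e c e *: Wd e) (\sum_e c' e *: Wd e) -> c =1 c'.
Proof.
move=> triT dS dS' c0 c'0 cS c'S' cc' e.
have Pf (A : {set edge n}) (a : edge n -> R) : dissection A -> (forall e, 0 <= a e) ->
    (forall e, e \notin A -> a e = 0) -> Pf1plus (\sum_e a e *: Wd e).
  by rewrite -[X in Pf1plus X]add0r; apply: dissection_combination_Pf; rewrite mem0v.
have := Pf_eqmod triT (Pf S c dS c0 cS) (Pf S' c' dS' c'0 c'S') cc'.
rewrite -sumrB; under eq_bigr do rewrite -scalerBl.
have [be _|nbe H] := boolP (boundary e).
  rewrite cS ?c'S' //.
    by apply: contraL be => /(dissection_nb dS').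
  by apply: contraL be => /(dissection_nb dS).
by apply/subr0_eq/(sum_W_L (c := fun f => c f - c' f) nbe).
Qed.

(** The side {0, n-1} cuts off all vertices but n-1, hence gives the star at its upper end; every
    other side gives the star at its lower end. *)
Lemma boundary_L e : boundary e -> Wd e \in L.
Proof.
rewrite boundaryE => be; apply/linealityP => //.
have lte := lo_lt_hi e; have ltn := ltn_ord (hi e).
have n1 : (0 < n)%N by lia.
pose k := if (hi e == (lo e).+1 :> nat)%N then lo e else hi e.
exists (fun x => (x == k)%:R) => p; rewrite WdiagE // /side -!val_eqE /= /k.
have ltp := lo_lt_hi p; have ltpn := ltn_ord (hi p).
have [E|nE] := eqVneq (hi e : nat) (lo e).+1.
  have -> : (lo e <= lo p < hi e)%N = (lo p == lo e :> nat) by rewrite E; lia.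
  have -> : (lo e <= hi p < hi e)%N = (hi p == lo e :> nat) by rewrite E; lia.
  case: eqP => [|_]; case: eqP => [|_] //=; rewrite ?addr0 ?add0r //; lia.
have -> : (lo e <= lo p < hi e)%N by lia.
have -> : (lo e <= hi p < hi e)%N = ~~ (hi p == hi e :> nat) by lia.
have -> : (lo p == hi e :> nat) = false by lia.
by rewrite add0r; case: eqP.
Qed.

Definition cost e : R := \sum_p (Wd e p : R).

Lemma cost_gt0 e : 0 < cost e.
Proof.
have We : Wd e e = 1 by rewrite WdiagE /side leqnn lo_lt_hi ltnn andbF.
rewrite /cost (bigD1 e) //= We ltr_pwDl //.
by apply: sumr_ge0 => p _; rewrite WdiagE ler0n.
Qed.

(* For crossing e = {i, j}, f = {k, l} with i < k < j < l, the cuts along e and f split the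
   vertices into A = [i, k), B = [k, j), C = [j, l) and the rest D. The metrics W_e + W_f,
   W_A + W_C and W_B + W_D differ only on the pairs A-C and B-D, and T cannot contain edges
   of both kinds since these cross. *)
Section Exchange.
Variables e f : edge n.
Hypotheses (lt1 : (lo e < lo f)%N) (lt2 : (lo f < hi e)%N) (lt3 : (hi e < hi f)%N).

Let A x := (lo e <= x < lo f)%N.
Let B x := (lo f <= x < hi e)%N.
Let C x := (hi e <= x < hi f)%N.
Let D x := ~~ [|| A x, B x | C x].
Definition AC (p : edge n) := A (lo p) && C (hi p) || C (lo p) && A (hi p).
Definition BD (p : edge n) := B (lo p) && D (hi p) || D (lo p) && B (hi p).

Lemma side_AB x : side e x = A x || B x. Proof. by rewrite /side /A /B; lia. Qed.
Lemma side_BC x : side f x = B x || C x. Proof. by rewrite /side /B /C; lia. Qed.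
Lemma ABC_disjoint x : [&& ~~ (A x && B x), ~~ (A x && C x) & ~~ (B x && C x)].
Proof. by rewrite /A /B /C; lia. Qed.

Lemma resolve_AC : exists g h,
  [/\ lo g = lo e, hi g = lo f, lo h = hi e, hi h = hi f &
   forall p, Wd e p + Wd f p = (Wd g p + Wd h p : R) + 2 * (BD p)%:R].
Proof.
exists (mkedge lt1), (mkedge lt3); split=> // p.
rewrite !WdiagE !side_AB !side_BC /side /lo /hi /=.
rewrite -/(lo p) -/(hi p) -/(lo e) -/(hi e) -/(lo f) -/(hi f).
rewrite -/(A (lo p)) -/(A (hi p)) -/(C (lo p)) -/(C (hi p)) /BD /D.
move: (ABC_disjoint (lo p)) (ABC_disjoint (hi p)).
by case: (A (lo p)) (B (lo p)) (C (lo p)) => [] [] [] //= _;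
   case: (A (hi p)) (B (hi p)) (C (hi p)) => [] [] [] //= _; ring.
Qed.

(** The interval of [h] is the union of A, B and C; its split is that of the complement D. *)
Lemma resolve_BD : exists g h,
  [/\ lo g = lo f, hi g = hi e, lo h = lo e, hi h = hi f &
   forall p, Wd e p + Wd f p = (Wd g p + Wd h p : R) + 2 * (AC p)%:R].
Proof.
exists (mkedge lt2), (mkedge (ltn_trans lt1 (ltn_trans lt2 lt3))); split=> // p.
set g := mkedge lt2; set h := mkedge _.
have sg x : side g x = B x by [].
have sh x : side h x = [|| A x, B x | C x].
  rewrite /side /A /B /C; have -> : lo h = lo e by []; have -> : hi h = hi f by [].
  lia.
rewrite !WdiagE !side_AB !side_BC !sg !sh /AC.
move: (ABC_disjoint (lo p)) (ABC_disjoint (hi p)).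
by case: (A (lo p)) (B (lo p)) (C (lo p)) => [] [] [] //= _;
   case: (A (hi p)) (B (hi p)) (C (hi p)) => [] [] [] //= _; ring.
Qed.

(** Together with [BD_f] this shows that neither error term is zero, so either resolution lowers the
    cost strictly. *)
Lemma AC_e : AC e.
Proof. by rewrite /AC /A /C; lia. Qed.

Lemma BD_f : BD f.
Proof. by rewrite /BD /D /A /B /C; lia. Qed.

Lemma AC_BD_cross p q : AC p -> BD q -> cross p q.
Proof.
have := lo_lt_hi p; have := lo_lt_hi q.
rewrite /AC /BD /D /A /B /C /cross => ? ? /orP[] /andP[? ?] /orP[] /andP[? ?]; lia.
Qed.

Lemma AC_or_BD T : triangulation T ->
  (forall p, p \in T -> ~~ BD p) \/ (forall p, p \in T -> ~~ AC p).
Proof.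
move=> triT; have [[p pT ACp]|noAC] := pselect (exists2 p, p \in T & AC p).
  left=> q qT; apply/negP => /(AC_BD_cross ACp); exact/negP/(triangulation_nc triT).
by right=> p pT; apply/negP => ACp; apply: noAC; exists p.
Qed.

(** The resolution taken is one whose error term vanishes on [T]. The disjunction records which one,
    so that a known edge of [T] in the error set can exclude the other. *)
Lemma resolve T : triangulation T -> exists g h,
  [/\ forall p, p \in T -> Wd e p + Wd f p = (Wd g p + Wd h p : R),
      cost g + cost h < cost e + cost f
    & [/\ lo g = lo e, hi g = lo f, lo h = hi e, hi h = hi f & forall p, p \in T -> ~~ BD p] \/
      [/\ lo g = lo f, hi g = hi e, lo h = lo e, hi h = hi f & forall p, p \in T -> ~~ AC p]].
Proof.
have lt_cost g h (P : pred (edge n)) p0 : P p0 ->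
    (forall p, Wd e p + Wd f p = (Wd g p + Wd h p : R) + 2 * (P p)%:R) ->
    cost g + cost h < cost e + cost f.
  move=> Pp0 H; rewrite /cost -!big_split /=.
  rewrite [X in _ < X](eq_bigr _ (fun p _ => H p)) [X in _ < X]big_split /= ltrDl (bigD1 p0) //= Pp0.
  by apply: ltr_pwDl; [rewrite mulr1 ltr0n|apply: sumr_ge0 => p _; rewrite mulr_ge0].
move=> /AC_or_BD[noBD|noAC].
  have [g [h [g1 g2 h1 h2 H]]] := resolve_AC.
  exists g, h; split; [|exact: lt_cost BD_f H|by left].
  by move=> p /noBD/negPf nBD; rewrite H nBD mulr0 addr0.
have [g [h [g1 g2 h1 h2 H]]] := resolve_BD.
exists g, h; split; [|exact: lt_cost AC_e H|by right].
by move=> p /noAC/negPf nAC; rewrite H nAC mulr0 addr0.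
Qed.

End Exchange.

Lemma exchange T e f : triangulation T -> cross e f -> exists g h,
  (forall p, p \in T -> Wd e p + Wd f p = (Wd g p + Wd h p : R)) /\
  cost g + cost h < cost e + cost f.
Proof.
move=> triT; rewrite /cross => /orP[] /and3P[lt1 lt2 lt3].
  by have [g [h [H1 H2 _]]] := resolve lt1 lt2 lt3 triT; exists g, h.
have [g [h [H1 H2 _]]] := resolve lt1 lt2 lt3 triT.
by exists g, h; split=> [p /H1 <-|]; [rewrite addrC|rewrite [ltRHS]addrC].
Qed.

Lemma eqmod_boundary T e f g h : boundary g -> boundary h ->
  (forall p, p \in T -> Wd e p + Wd f p = (Wd g p + Wd h p : R)) ->
  eqmod T (Wd e + Wd f) 0.
Proof.
move=> bg bh H; exists (Wd g + Wd h); first by rewrite memvD ?boundary_L.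
by move=> p /H; rewrite !ffunE add0r.
Qed.

(** The edge [e] of [T] lies in one of the two error sets, which excludes one resolution; the other
    one gives sides of the polygon because [e] and its rotation have adjacent ends. If [hi e] wraps
    around, the rotation comes first and the roles of the two resolutions are exchanged. *)
Lemma rotate_opposite T e : triangulation T -> e \in T -> ~~ boundary e ->
  eqmod T (Wd e + Wd (rotate e)) 0.
Proof.
move=> triT eT; rewrite boundaryE => nbe; have := lo_lt_hi e; have := ltn_ord (hi e).
case: (rotateE e) => [] [hn [lor hir]] ltn lte.
  have [|||g [h [H _ [[g1 g2 h1 h2 _]|[_ _ _ _ noAC]]]]] :=
    @resolve e (rotate e) _ _ _ T triT; try lia.
    by apply: (eqmod_boundary _ _ H); rewrite boundaryE ?g1 ?g2 ?h1 ?h2 ?lor ?hir eqxx.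
  by have := noAC e eT; rewrite AC_e //; lia.
have [|||g [h [H _ [[_ _ _ _ noBD]|[g1 g2 h1 h2 _]]]]] :=
  @resolve (rotate e) e _ _ _ T triT; try lia.
  by have := noBD e eT; rewrite BD_f //; lia.
rewrite addrC; apply: (eqmod_boundary _ _ H); rewrite boundaryE ?g1 ?g2 ?h1 ?h2 ?lor ?hir ?eqxx //.
by rewrite hn !eqxx orbT.
Qed.

Lemma resolve_boundary T e f : triangulation T -> cross e f ->
  ~~ boundary e -> ~~ boundary f ->
  exists g h, (forall p, p \in T -> Wd e p + Wd f p = (Wd g p + Wd h p : R)) /\
   [/\ ~~ cross g h &
   (boundary g -> boundary h -> e \in T /\ f = rotate e \/ f \in T /\ e = rotate f)].
Proof.
wlog lt_ef : e f / (lo e < lo f)%N.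
  move=> H triT cef nbe nbf; have := cef; rewrite /cross => /orP[] /and3P[lt1 _ _].
    exact: H.
  have [|g' [h' [H1 [H2 H3]]]] := H f e lt1 triT _ nbf nbe; first by rewrite crossC.
  exists g', h'; split; last by split=> // bg bh; have [|] := H3 bg bh; tauto.
  by move=> p /H1 <-; rewrite addrC.
move=> triT cef nbe nbf.
have lt2 : (lo f < hi e)%N by move: cef; rewrite /cross; lia.
have lt3 : (hi e < hi f)%N by move: cef; rewrite /cross; lia.
move: nbe nbf; rewrite !boundaryE => nbe nbf.
have rot (a b : edge n) : lo b = (lo a).+1 :> nat -> hi b = (hi a).+1 :> nat -> b = rotate a.
  move=> lob hib; have := ltn_ord (hi b).
  by case: (rotateE a) => [] [? [? ?]] ?; apply: edge_eq; lia.
have rot0 (a b : edge n) : lo b = 0%N :> nat -> hi b = (lo a).+1 :> nat ->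
    hi a = n.-1 :> nat -> b = rotate a.
  move=> lob hib hia; have := ltn_ord (hi b).
  by case: (rotateE a) => [] [? [? ?]] ?; apply: edge_eq; lia.
have ltn := ltn_ord (hi f).
have [g' [h' [H _ D]]] := resolve lt_ef lt2 lt3 triT.
exists g', h'; split=> //; split.
  have := lo_lt_hi g'; have := lo_lt_hi h'; rewrite /cross.
  by case: D => [[-> -> -> -> _]|[-> -> -> -> _]]; lia.
rewrite !boundaryE; case: D => [[-> -> -> -> noBD]|[-> -> -> -> noAC]] bg bh.
  (* As [g'] and [h'] are sides of the polygon, the pairs B-D are exactly those crossing [e]; [T]
     contains none of them, so [e] is in [T] by maximality. The second case is the same with A-C and
     [f]. *)
  left; split; last by apply: rot; lia.
  apply: contrapT => /negP /(triangulation_cross triT)[p pT].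
  have := noBD p pT; have := lo_lt_hi p; have := ltn_ord (hi p).
  by rewrite /BD /cross; lia.
right; split; last by apply: rot0; lia.
apply: contrapT => /negP /(triangulation_cross triT)[p pT].
have := noAC p pT; have := lo_lt_hi p; have := ltn_ord (hi p).
by rewrite /AC /cross; lia.
Qed.

Lemma dist_eqT T v w e x y : (forall p, p \in T -> v p = w p) -> e \in T ->
  (lo e = x :> nat /\ hi e = y :> nat \/ lo e = y :> nat /\ hi e = x :> nat) ->
  dist v x y = dist w x y.
Proof.
move=> vw eT [] [/ord_inj <- /ord_inj <-]; last rewrite ![dist _ (hi e) _]distC;
by rewrite !dist_edge vw.
Qed.

(* The witnesses are the vertices of the quadrilateral of T around e. *)
Lemma dual_functional T e : triangulation T -> e \in T -> ~~ boundary e ->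
  exists a b c d : 'I_n, [/\ apart a b c d,
    forall v w, eqmod T v w -> crossratio v a b c d = crossratio w a b c d,
    forall f, crossratio (Wd f) a b c d \in [:: 0; 2; -2]
  & forall f, f \in T -> crossratio (Wd f) a b c d = - 2 * (f == e)%:R].
Proof.
move=> triT eT nbe; have := nbe; rewrite boundaryE => nbe'; have h5 := lo_lt_hi e.
have [|f1 [g1 [f1T g1T lof1 fg1 hig1]]] := inner_triangle triT eT; first by lia.
clear nbe'; have [f2 [g2 [f2T g2T quad2]]] := outer_triangle triT eT nbe.
have h1 := lo_lt_hi f1; have h2 := lo_lt_hi g1.
have h3 := lo_lt_hi f2; have h4 := lo_lt_hi g2.
(* The apex of the outer triangle; [oP] treats its two possible positions uniformly. *)
pose o := if (lo f2 < lo e)%N then lo f2 else hi f2.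
have oP : lo f2 = lo g2 :> nat /\ hi f2 = lo e :> nat /\ hi g2 = hi e :> nat /\ o = lo f2 :> nat \/
          lo f2 = hi e :> nat /\ lo g2 = lo e :> nat /\ hi f2 = hi g2 :> nat /\ o = hi f2 :> nat.
  by clear - quad2 h3 h4 h5; rewrite /o; case: quad2 => [] [? ? ?]; case: ltnP => ?; lia.
clear quad2; have ap : apart (lo e) (hi e) (hi f1) o.
  by rewrite /apart; clearbody o; case: oP => [] [? [? [? ?]]]; lia.
exists (lo e), (hi e), (hi f1), o; split=> //.
(* The four distances in this cross-ratio are the sides of the quadrilateral, all of which are edges
   of [T]. *)
- move=> v w [l lL H]; rewrite -[RHS]addr0 -(crossratio_L n_ge4 lL ap) -crossratioD //.
  have vw p : p \in T -> v p = (w + l) p by move=> /H ->; rewrite ffunE.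
  rewrite /crossratio (dist_eqT vw f1T); last by left; rewrite lof1.
  rewrite (dist_eqT vw g1T (x := hi e) (y := hi f1)); last by right; rewrite hig1 fg1.
  case: oP => [] [o1 [o2 [o3 o4]]].
    rewrite (dist_eqT vw g2T (x := hi e) (y := o)); last by right; rewrite o4 -o1.
    by rewrite (dist_eqT vw f2T (x := lo e) (y := o)); last by right; rewrite o4.
  rewrite (dist_eqT vw f2T (x := hi e) (y := o)); last by left; rewrite o4.
  by rewrite (dist_eqT vw g2T (x := lo e) (y := o)); last by left; rewrite o4 -o3.
- move=> f; rewrite crossratio_W //.
  case: (side f _) (side f _) (side f _) (side f _) => [] [] [] [] /=;
    rewrite ?subrr ?mulr0 ?mul0r ?subr0 ?sub0r ?mulrN1 ?mulr1 ?opprK !inE ?eqxx ?orbT //.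
- move=> f fT; rewrite crossratio_W //.
have fc1 : (lo e < hi f1)%N by rewrite -lof1.
have fc2 : (hi f1 < hi e)%N by rewrite fg1 -hig1.
have [->|nef] := eqVneq f e.
  have -> : side e (lo e) by rewrite /side leqnn h5.
  have -> : side e (hi e) = false by rewrite /side ltnn andbF.
  have -> : side e (hi f1) by rewrite /side ltnW.
  have -> : side e o = false.
    by rewrite /side; clearbody o; clear - oP h3 h4 h5; case: oP; lia.
  by rewrite /=; ring.
have [->|ne1] := eqVneq (side f (lo e)) (side f (hi e)); first by rewrite subrr !mulr0 mul0r.
have [->|ne2] := eqVneq (side f (hi f1)) (side f o); first by rewrite subrr !mulr0.
(* A nonzero value means that [f] separates the ends of [e] and also the two apexes. Since [f]
   crosses neither [e] nor a side of the quadrilateral, it would have to be [e]. *)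
exfalso; clearbody o; have h6 := lo_lt_hi f.
have N1 := nested triT eT fT; have N2 := nested triT fT eT.
have N3 := nested triT fT g1T; have N4 := nested triT f2T fT.
have N5 := nested triT g2T fT; have N6 := nested triT fT g2T.
have f_e : lo f = lo e :> nat -> hi f = hi e :> nat -> False.
  by move=> lo_fe hi_fe; move/eqP: nef; apply; apply: edge_eq.
move: ne1 ne2; rewrite /side.
clear - oP h1 h2 h3 h4 h5 h6 lof1 fg1 hig1 N1 N2 N3 N4 N5 N6 f_e => ne1 ne2.
have [/andP[in1 in2]|out] := boolP (lo f <= lo e < hi f)%N; last first.
  have lof : lo f = hi e :> nat by move: N1 ne1 out; clear - h5 h6; lia.
  case: oP => [] [? [? [? ?]]]; first by clear N1 N2 N3 N4 N5 N6; lia.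
  by clear N1 N2 N3 N4; lia.
have le_fe : (hi f <= hi e)%N by move: ne1 in1 in2; clear - h5 h6; lia.
have [lo_fe|lo_fe] := eqVneq (lo f : nat) (lo e).
  have lt_fe : (hi f < hi e)%N by rewrite ltn_neqAle le_fe andbT; apply/eqP/f_e.
  have le_ff1 : (hi f <= hi f1)%N by clear N1 N2 N4 N5 N6 ne2 oP; lia.
  by clear N1 N2 N3 N4 N5 N6; case: oP => [] [? [? [? ?]]]; lia.
have hi_fe : hi f = hi e :> nat by clear N1 N3 N4 N5 N6 ne2 oP; lia.
clear N1 N2 N3; case: oP => [] [? [? [? ?]]]; first by clear N5 N6; lia.
by clear N4 N5; lia.
Qed.

End Modulo.

(** * Fans with an exchange relation *)

Section LinearAlgebra.
Variables (R : realType) (J E : finType).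
Local Notation V := {ffun J -> R^o}.
Implicit Types (u x y z : V) (w : E -> V) (A : {set E}).

Lemma dotDr u x y : dot u (x + y) = dot u x + dot u y.
Proof. by rewrite /dot -big_split; apply: eq_bigr => j _; rewrite ffunE mulrDr. Qed.

Lemma dotC u x : dot u x = dot x u.
Proof. by apply: eq_bigr => j _; rewrite mulrC. Qed.

Lemma dotZr u (a : R) x : dot u (a *: x) = a * dot u x.
Proof. by rewrite /dot big_distrr; apply: eq_bigr => j _; rewrite ffunE /= mulrCA. Qed.

Lemma dotNr u x : dot u (- x) = - dot u x.
Proof. by rewrite -scaleN1r dotZr mulN1r. Qed.

Lemma dotBr u x y : dot u (x - y) = dot u x - dot u y.
Proof. by rewrite dotDr dotNr. Qed.

Lemma dot0r u : dot u 0 = 0.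
Proof. by rewrite /dot big1 // => j _; rewrite ffunE mulr0. Qed.

Lemma dot_sumr (I : finType) (P : pred I) u (F : I -> V) :
  dot u (\sum_(i | P i) F i) = \sum_(i | P i) dot u (F i).
Proof. by apply: (big_morph (dot u)) => [x y|]; rewrite ?dotDr ?dot0r. Qed.

Lemma dot_combr (I : finType) (P : pred I) u (c : I -> R) (F : I -> V) :
  dot u (\sum_(i | P i) c i *: F i) = \sum_(i | P i) c i * dot u (F i).
Proof. by rewrite dot_sumr; apply: eq_bigr => i _; rewrite dotZr. Qed.

Lemma dot_combl (I : finType) (P : pred I) u (c : I -> R) (F : I -> V) :
  dot (\sum_(i | P i) c i *: F i) u = \sum_(i | P i) c i * dot (F i) u.
Proof. by rewrite dotC dot_combr; apply: eq_bigr => i _; rewrite dotC. Qed.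

Lemma dot_coord (f : {linear V -> R^o}) : exists z, forall x, dot x z = f x.
Proof.
pose d j : V := [ffun k => (k == j)%:R].
exists [ffun j => f (d j)] => x.
have {2}-> : x = \sum_j x j *: d j.
  apply/ffunP => k; rewrite sum_ffunE (bigD1 k) //= big1 => [|j ne].
    by rewrite !ffunE eqxx addr0 /GRing.scale /= mulr1.
  by rewrite !ffunE eq_sym (negPf ne) scaler0.
by rewrite linear_sum; apply: eq_bigr => j _; rewrite linearZ ffunE.
Qed.

Definition independent w A :=
  forall a : E -> R, \sum_(e in A) a e *: w e = 0 -> forall e, e \in A -> a e = 0.

Lemma nth_map_enum w A (i : 'I_#|A|) :
  (map_tuple w (enum_tuple A))`_i = w (enum_val i).
Proof. by rewrite -tnth_nth tnth_map; congr (w _); rewrite (tnth_nth (enum_val i)) -enum_val_nth. Qed.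

Lemma independent_free w A : independent w A <-> free (map_tuple w (enum_tuple A)).
Proof.
split=> [ind|/freeP fr a sum0 e eA].
  apply/freeP => k sum0 i.
  (* Moves coefficients from positions to elements; [enum_val] is injective, so the sum has at most
     one term. *)
  pose a e := \sum_(j | enum_val j == e) k j.
  have aE j : a (enum_val j) = k j.
    rewrite /a (bigD1 j) //= big1 ?addr0 // => l /andP[/eqP/enum_val_inj -> ].
    by rewrite eqxx.
  rewrite -aE; apply: ind (enum_valP i).
  rewrite big_enum_val -[RHS]sum0; apply: eq_bigr => j _.
  by rewrite aE nth_map_enum.
rewrite -(enum_rankK_in eA eA).
apply: (fr (fun i => a (enum_val i))).
rewrite -[RHS]sum0 [RHS]big_enum_val; apply: eq_bigr => j _.
by rewrite nth_map_enum.
Qed.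

Lemma independent_dual w A : independent w A ->
  exists D : E -> V, forall e f, e \in A -> f \in A -> dot (w e) (D f) = (e == f)%:R.
Proof.
move=> /independent_free fr; set X := map_tuple w _ in fr.
have zP i : {z : V | forall x, dot x z = coord X i x}.
  by apply: cid; exact: (dot_coord (coord X i)).
have DP f : {z : V | forall e, e \in A -> f \in A -> dot (w e) z = (e == f)%:R}.
  apply: cid; have [fA|fA] := boolP (f \in A); last by exists 0.
  exists (sval (zP (enum_rank_in fA f))) => e eA _.
  rewrite (svalP (zP _)) -{1}(enum_rankK_in fA eA) -nth_map_enum coord_free //.
  congr (_%:R); congr nat_of_bool; apply/eqP/eqP => [H|->//].
  exact: (can_in_inj (@enum_rankK_in _ _ _ fA) eA).
by exists (fun f => sval (DP f)) => e f eA fA; exact: (svalP (DP f)).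
Qed.

Lemma independent_basis w A : independent w A -> #|A| = #|J| ->
  basis_of fullv (map_tuple w (enum_tuple A)).
Proof.
move=> /independent_free fr cardA; rewrite basisEfree fr subvf /= size_tuple dimvf.
by rewrite /dim /= cardA muln1.
Qed.

Lemma independent_span w A : independent w A -> #|A| = #|J| ->
  forall y, exists a : E -> R, y = \sum_(e in A) a e *: w e.
Proof.
move=> ind cardA y; have bX := independent_basis ind cardA.
have := coord_basis bX (memvf y); set X := map_tuple w _ => ->.
exists (fun e => \sum_(j | enum_val j == e) coord X j y).
rewrite [RHS]big_enum_val; apply: eq_bigr => i _; rewrite nth_map_enum.
rewrite (bigD1 i) //= big1 ?addr0 // => l /andP[/eqP/enum_val_inj ->].
by rewrite eqxx.
Qed.

End LinearAlgebra.

(* w are the rays, dis the sets spanning a cone, mx the maximal ones; h is a cost which strictly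
   decreases under exchange. *)
Section PolytopalFan.
Variables (R : realType) (J E : finType).
Local Notation V := {ffun J -> R^o}.
Variables (w : E -> V) (h : E -> R) (dis mx : pred {set E}).
Implicit Types (u x y z : V) (A S M : {set E}) (c : E -> R).

Definition comb c : V := \sum_e c e *: w e.
Definition weight c : R := \sum_e c e * h e.
Definition supp c : {set E} := [set e | c e != 0]%SET.

Hypothesis h_gt0 : forall e, 0 < h e.
Hypothesis dis_sub : forall S S', S' \subset S -> dis S -> dis S'.
Hypothesis mx_dis : forall M, mx M -> dis M.
Hypothesis mx_ext : forall S, dis S -> exists2 M, mx M & S \subset M.
Hypothesis mx_card : forall M, mx M -> #|M| = #|J|.
Hypothesis mx_flip : forall M e, mx M -> e \in M ->
  exists M', [/\ mx M', M :\ e \subset M' & e \notin M'].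
Hypothesis w_span : forall y, exists2 c, (forall e, 0 <= c e) & comb c = y.
Hypothesis w_exchange : forall S, ~~ dis S -> exists e f g,
  [/\ e \in S, f \in S, forall k, 0 <= g k, comb g = w e + w f & weight g < h e + h f].
Hypothesis w_uniq : forall S S' c c', dis S -> dis S' ->
  (forall e, 0 <= c e) -> (forall e, 0 <= c' e) ->
  (forall e, e \notin S -> c e = 0) -> (forall e, e \notin S' -> c' e = 0) ->
  comb c = comb c' -> c =1 c'.

(** * Nonnegative combinations of rays and their minimal cost *)

Lemma comb_lin (a b : R) c c' : comb (fun e => a * c e + b * c' e) = a *: comb c + b *: comb c'.
Proof.
rewrite /comb !scaler_sumr -big_split; apply: eq_bigr => e _.
by rewrite scalerDl !scalerA.
Qed.

Lemma weight_lin (a b : R) c c' : weight (fun e => a * c e + b * c' e) = a * weight c + b * weight c'.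
Proof. by rewrite /weight !big_distrr -big_split; apply: eq_bigr => e _ /=; ring. Qed.

Lemma eq_weight c c' : c =1 c' -> weight c = weight c'.
Proof. by move=> cc'; apply: eq_bigr => e _; rewrite cc'. Qed.

Lemma comb_on A c : (forall e, e \notin A -> c e = 0) -> comb c = \sum_(e in A) c e *: w e.
Proof.
by move=> cA; rewrite [RHS]big_mkcond; apply: eq_bigr => e _; case: ifPn => // /cA ->; rewrite scale0r.
Qed.

Lemma weight_on A c : (forall e, e \notin A -> c e = 0) -> weight c = \sum_(e in A) c e * h e.
Proof.
by move=> cA; rewrite [RHS]big_mkcond; apply: eq_bigr => e _; case: ifPn => // /cA ->; rewrite mul0r.
Qed.

Definition cutoff A c : E -> R := fun e => if e \in A then c e else 0.

Lemma cutoff_out A c e : e \notin A -> cutoff A c e = 0.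
Proof. by rewrite /cutoff => /negPf ->. Qed.

Lemma comb_cutoff A c : comb (cutoff A c) = \sum_(e in A) c e *: w e.
Proof. by rewrite (comb_on (@cutoff_out A c)); apply: eq_bigr => e eA; rewrite /cutoff eA. Qed.

Lemma weight_cutoff A c : weight (cutoff A c) = \sum_(e in A) c e * h e.
Proof. by rewrite (weight_on (@cutoff_out A c)); apply: eq_bigr => e eA; rewrite /cutoff eA. Qed.

Lemma supp_out c e : e \notin supp c -> c e = 0.
Proof. by rewrite inE negbK => /eqP. Qed.

Definition delta (e : E) : E -> R := fun f => (f == e)%:R.

Lemma comb_delta e : comb (delta e) = w e.
Proof.
rewrite /comb (bigD1 e) //= /delta eqxx scale1r big1 ?addr0 // => f ne.
by rewrite (negPf ne) scale0r.
Qed.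

Lemma weight_delta e : weight (delta e) = h e.
Proof.
rewrite /weight (bigD1 e) //= /delta eqxx mul1r big1 ?addr0 // => f ne.
by rewrite (negPf ne) mul0r.
Qed.

(** A step of Carathéodory's argument that respects the cost: a linear relation on the support, with
    sign chosen to make its weight nonnegative, is subtracted until a coefficient first reaches
    zero. *)
Lemma cheaper_smaller c : (forall e, 0 <= c e) -> ~ independent w (supp c) ->
  exists c', [/\ forall e, 0 <= c' e, comb c' = comb c, weight c' <= weight c
    & supp c' \proper supp c].
Proof.
move=> c0 nind.
have [a [a_out a_comb a_tot [e0 a_e0]]] : exists a, [/\ forall e, e \notin supp c -> a e = 0,
    comb a = 0, 0 <= weight a & exists e, a e != 0].
  have [a [sum0 [e [eA ae]]]] : exists a, \sum_(e in supp c) a e *: w e = 0 /\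
      exists e, e \in supp c /\ a e != 0.
    apply: contrapT => H; apply: nind => a sum0 e eA; apply: contrapT => ae.
    by apply: H; exists a; split=> //; exists e; split=> //; apply/eqP.
  have [tot|tot] := leP 0 (weight (cutoff (supp c) a)).
    exists (cutoff (supp c) a); split=> //; first exact: cutoff_out.
      by rewrite comb_cutoff.
    by exists e; rewrite /cutoff eA.
  exists (fun e => -1 * cutoff (supp c) a e + 0 * 0); split.
  - by move=> f /cutoff_out ->; rewrite !mulr0 addr0.
  - by rewrite (comb_lin _ _ _ (fun=> 0)) comb_cutoff sum0 scaler0 scale0r addr0.
  - by rewrite (weight_lin _ _ _ (fun=> 0)) mul0r addr0 mulN1r oppr_ge0 ltW.
  - by exists e; rewrite mul0r addr0 mulN1r oppr_eq0 /cutoff eA.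
(* Otherwise [a] is nonpositive and nonzero, and its weight would be negative because [h] is
   positive. *)
have [e1 a_e1] : exists e, 0 < a e.
  apply: contrapT => H; have a_le0 e : a e <= 0 by rewrite leNgt; apply/negP => ae; apply: H; exists e.
  move: a_tot; apply/negP; rewrite -ltNge /weight (bigD1 e0) //=.
  apply: ltr_nwDl; first by rewrite nmulr_rlt0 // lt_neqAle a_e0 a_le0.
  by apply: sumr_le0 => e _; rewrite mulr_le0_ge0 // ltW.
(* The minimal ratio is the largest multiple of [a] that can be subtracted without making a
   coefficient negative. *)
have [e a_e min_e] := @Order.TotalTheory.arg_minP _ R E e1 (fun e => 0 < a e) (fun e => c e / a e) a_e1.
set t := c e / a e in min_e.
have t0 : 0 <= t by rewrite divr_ge0 // ltW.
exists (fun f => 1 * c f + (- t) * a f); split.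
- move=> f; have [af|af] := ltP 0 (a f).
    by have := min_e f af; rewrite ler_pdivlMr // mul1r mulNr subr_ge0.
  by rewrite mul1r addr_ge0 // mulr_le0 // oppr_le0.
- by rewrite comb_lin a_comb scaler0 addr0 scale1r.
- by rewrite weight_lin mul1r mulNr gerDl oppr_le0 mulr_ge0.
apply/fintype.properP; split.
  apply/fintype.subsetP => f; rewrite [f \in supp _]inE; apply: contraR => fc.
  by rewrite (supp_out fc) a_out // !mulr0 addr0.
have ae0 : a e != 0 by rewrite gt_eqF.
exists e; first by apply: contraR ae0 => /a_out ->.
by rewrite inE negbK mul1r /t mulNr divfK // subrr.
Qed.

Lemma basic_representation c : (forall e, 0 <= c e) ->
  exists c', [/\ forall e, 0 <= c' e, comb c' = comb c, weight c' <= weight c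
    & independent w (supp c')].
Proof.
have [m] := ubnP #|supp c|; elim: m c => // m IH c; rewrite ltnS => le_m c0.
have [ind|nind] := pselect (independent w (supp c)); first by exists c.
have [c1 [c10 comb1 tot1 /proper_card lt1]] := cheaper_smaller c0 nind.
have [|c2 [c20 comb2 tot2 ind2]] := IH c1 _ c10; first exact: leq_trans lt1 le_m.
by exists c2; split=> //; [rewrite comb2|exact: le_trans tot2 tot1].
Qed.

(** An independent support determines its coefficients, so there are finitely many basic
    representations, one at most for each subset, and the cheapest of them is minimal among all by
    [basic_representation]. *)
Lemma minimal_representation y : exists c, [/\ forall e, 0 <= c e, comb c = y &
  forall c', (forall e, 0 <= c' e) -> comb c' = y -> weight c <= weight c'].
Proof.
pose Q A c := [/\ forall e, 0 <= c e, comb c = y, supp c = A & independent w A].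
have QP A : {c | (exists c', Q A c') -> Q A c}.
  by apply: cid; have [[c' Qc']|no] := pselect (exists c', Q A c'); [exists c'|exists (fun=> 0)].
pose cA A := sval (QP A); have cAP A c' : Q A c' -> Q A (cA A) /\ cA A =1 c'.
  move=> Qc'; have QA : Q A (cA A) by apply: (svalP (QP A)); exists c'.
  split=> // e; case: QA Qc' => _ comb1 supp1 ind [_ comb2 supp2 _].
  have [eA|eA] := boolP (e \in A); last by rewrite !supp_out ?supp1 ?supp2.
  apply/subr0_eq/(ind (fun e => cA A e - c' e)) => //.
  under eq_bigr do rewrite scalerBl.
  rewrite sumrB -!comb_on ?comb1 ?comb2 ?subrr // => f fA.
    by apply: supp_out; rewrite supp2.
  by apply: supp_out; rewrite supp1.
have basic c : (forall e, 0 <= c e) -> comb c = y ->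
    exists2 A, `[< exists c', Q A c' >] & weight (cA A) <= weight c.
  move=> c0 cy; have [c' [c'0 comb' tot' ind']] := basic_representation c0.
  have Qc' : Q (supp c') c' by split=> //; rewrite comb'.
  exists (supp c'); first by apply/asboolP; exists c'.
  by rewrite (eq_weight (cAP _ _ Qc').2).
have [c0 c00 c0y] := w_span y; have [A0 QA0 _] := basic c0 c00 c0y.
have [A /asboolP[c' /cAP[[? ? ? ?] _]] minA] :=
  @Order.TotalTheory.arg_minP _ R _ A0 (fun A => `[< exists c', Q A c' >]) (fun A => weight (cA A)) QA0.
exists (cA A); split=> // c1 c10 c1y; have [A1 QA1] := basic c1 c10 c1y.
by apply: le_trans; exact: minA.
Qed.

Lemma minimal_supp c : (forall e, 0 <= c e) ->
  (forall c', (forall e, 0 <= c' e) -> comb c' = comb c -> weight c <= weight c') ->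
  dis (supp c).
Proof.
move=> c0 minc; apply: contrapT => /negP /w_exchange[e [f [g [ec fc g0 comb_g tot_g]]]].
have ce : 0 < c e by rewrite lt_neqAle c0 eq_sym; move: ec; rewrite inE => ->.
have cf : 0 < c f by rewrite lt_neqAle c0 eq_sym; move: fc; rewrite inE => ->.
(* Half the minimum, since [e] and [f] may coincide and then 2t is taken from a single
   coefficient. *)
pose t := Num.min (c e) (c f) / 2.
have t0 : 0 < t by rewrite divr_gt0 // lt_min ce cf.
have te : t + t <= c e by rewrite /t -splitr ge_min lexx.
have tf : t + t <= c f by rewrite /t -splitr ge_min lexx orbT.
pose c1 k := 1 * c k + t * (1 * g k + (- 1) * (1 * delta e k + 1 * delta f k)).
have c1E : comb c1 = comb c.
  by rewrite /c1 comb_lin comb_lin comb_lin !comb_delta comb_g !scale1r scaleN1r subrr scaler0 addr0.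
have := minc c1 _ c1E.
have -> : weight c1 = weight c + t * (weight g - (h e + h f)).
  by rewrite /c1 weight_lin weight_lin weight_lin !weight_delta; ring.
have : t * (weight g - (h e + h f)) < 0 by rewrite pmulr_rlt0 // subr_lt0.
move=> neg /(_ _)/wrap[|]; last by lra.
move=> k; have tg : 0 <= t * g k by rewrite mulr_ge0 ?g0 // ltW.
have tke : k = e -> t + t <= c k by move=> ->.
have tkf : k = f -> t + t <= c k by move=> ->.
have ck := c0 k; rewrite /c1 /delta.
by have [/tke|_] := eqVneq k e; have [/tkf|_] := eqVneq k f; rewrite /=; lra.
Qed.

(** A competitor of no larger cost is minimal too, so its support is also in [dis] and [w_uniq]
    identifies the two. *)
Lemma representation y : exists S c, [/\ dis S, forall e, 0 <= c e,
  forall e, (e \notin S) = (c e == 0), comb c = y & forall c', (forall e, 0 <= c' e) ->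
  comb c' = y -> weight c <= weight c' /\ (weight c' <= weight c -> c' =1 c)].
Proof.
have [c [c0 cy minc]] := minimal_representation y; rewrite -cy in minc *.
have disc := minimal_supp c0 minc.
exists (supp c), c; split=> // [e|c' c'0 c'c]; first by rewrite inE negbK.
split=> [|le_c'c]; first exact: minc.
have disc' : dis (supp c').
  apply: minimal_supp => // c2 c20 c2c'; apply: le_trans le_c'c _; apply: minc => //.
  by rewrite c2c'.
by apply: (w_uniq disc' disc) => //; exact: supp_out.
Qed.

(* Strict convexity of the piecewise linear function given by h on the fan. *)
Lemma weight_min S c c' : dis S -> (forall e, 0 <= c e) -> (forall e, e \notin S -> c e = 0) ->
  (forall e, 0 <= c' e) -> comb c' = comb c -> weight c' <= weight c -> c' =1 c.
Proof.
move=> disS c0 cS c'0 c'c.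
have [S1 [c1 [dis1 c10 c1S c1c minc1]]] := representation (comb c).
have c1E : c1 =1 c.
  by apply: (w_uniq dis1 disS) => // e; rewrite c1S => /eqP.
move=> le e; rewrite -c1E; apply: (minc1 c' c'0 c'c).2.
by rewrite (eq_weight c1E).
Qed.

(** The positive and negative parts of a linear relation are two nonnegative representations of the
    same vector, hence equal, hence both zero. *)
Lemma dis_independent S : dis S -> independent w S.
Proof.
move=> disS a sum0 e eS.
pose p f : R := cutoff S (fun f => Num.max (a f) 0) f.
pose q f : R := cutoff S (fun f => Num.max (- a f) 0) f.
have p0 f : 0 <= p f by rewrite /p /cutoff; case: ifP => // _; rewrite le_max lexx orbT.
have q0 f : 0 <= q f by rewrite /q /cutoff; case: ifP => // _; rewrite le_max lexx orbT.
have pq : comb p = comb q.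
  rewrite !comb_cutoff; apply/subr0_eq; rewrite -sumrB -[RHS]sum0.
  apply: eq_bigr => f _; rewrite -scalerBl; congr (_ *: _).
  by rewrite !maxElt; case: ltP => ?; case: ltP => ?; lra.
have := w_uniq disS disS p0 q0 (@cutoff_out S _) (@cutoff_out S _) pq e.
by rewrite /p /q /cutoff eS !maxElt; case: ltP => ?; case: ltP => ?; lra.
Qed.

Lemma mx_dual M : mx M ->
  exists D : E -> V, forall e f, e \in M -> f \in M -> dot (w e) (D f) = (e == f)%:R.
Proof. by move=> /mx_dis/dis_independent/independent_dual. Qed.

Lemma mx_span M : mx M -> forall y, exists a : E -> R, y = \sum_(e in M) a e *: w e.
Proof. by move=> mxM; apply: independent_span (mx_card mxM); apply/dis_independent/mx_dis. Qed.

(** * The vertices of the polytope *)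

Lemma vertex_exists M : exists x, mx M -> forall e, e \in M -> dot (w e) x = h e.
Proof.
have [mxM|] := boolP (mx M); last by exists 0.
have [D DP] := mx_dual mxM; exists (\sum_(f in M) h f *: D f) => _ e eM.
rewrite dot_combr (bigD1 e) //= DP // eqxx mulr1 big1 ?addr0 // => f /andP[fM ne].
by rewrite DP // eq_sym (negPf ne) mulr0.
Qed.

Definition vertex M : V := sval (cid (vertex_exists M)).

Lemma vertexP M e : mx M -> e \in M -> dot (w e) (vertex M) = h e.
Proof. by move=> mxM; exact: (svalP (cid (vertex_exists M)) mxM e). Qed.

(** Adding a large multiple N of every ray of [M] to the expansion of [w e] gives two nonnegative
    representations of one vector, one of them supported on [M]. If the inequality failed, the other
    would cost no more, so [weight_min] would equate them; but their coefficients at [e] are 1 and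
    0. *)
Lemma vertex_lt M e : mx M -> e \notin M -> dot (w e) (vertex M) < h e.
Proof.
move=> mxM eM; have [a we] := mx_span mxM (w e).
pose N := \sum_(f in M) `|a f|.
have N0 : 0 <= N by apply: sumr_ge0.
have aN f : f \in M -> a f <= N.
  move=> fM; apply: le_trans (ler_norm _) _; rewrite /N (bigD1 f) //= lerDl.
  by apply: sumr_ge0.
pose c := cutoff M (fun=> N).
pose c' f := 1 * cutoff M (fun f => N - a f) f + 1 * delta e f.
rewrite ltNge; apply/negP => le_h.
have : c' =1 c.
  apply: (weight_min (mx_dis mxM)).
  - by move=> f; rewrite /c /cutoff; case: ifP.
  - exact: cutoff_out.
  - move=> f; rewrite /c' /cutoff !mul1r addr_ge0 ?ler0n //.
    by case: ifP => // fM; rewrite subr_ge0 aN.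
  - rewrite /c' comb_lin comb_delta !comb_cutoff !scale1r we -big_split.
    by apply: eq_bigr => f _ /=; rewrite -scalerDl subrK.
  rewrite /c' weight_lin weight_delta !weight_cutoff !mul1r.
  have : \sum_(f in M) a f * h f = dot (w e) (vertex M).
    by rewrite we dot_combl; apply: eq_bigr => f fM; rewrite vertexP.
  under [in X in X + _ <= _]eq_bigr do rewrite mulrBl.
  by rewrite sumrB; move=> ->; rewrite -addrA gerDl; lra.
move/(_ e); rewrite /c' /c /cutoff (negPf eM) /delta eqxx mulr0 add0r mulr1.
by move/eqP; rewrite oner_eq0.
Qed.

(* Its normal fan is the fan spanned by dis; vertex M is the linear function which agrees with
   h on the maximal cone M. *)
Definition fan_polytope : set V :=
  [set x | exists2 c : {set E} -> R, (forall M, 0 <= c M) /\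
     \sum_(M in [set M | mx M]%SET) c M = 1 &
     x = \sum_(M in [set M | mx M]%SET) c M *: vertex M].
Local Notation P := fan_polytope.

Lemma fan_polytope_polytope : polytope P.
Proof.
pose A := [set M | mx M]%SET.
exists #|A|, (fun i => vertex (enum_val i)); apply/seteqP; split=> x /=.
  move=> [c [c0 c1] ->]; exists (fun i => c (enum_val i)); last by rewrite [LHS]big_enum_val.
  by split=> //; rewrite -c1 [RHS]big_enum_val.
move=> [c [c0 c1] ->]; pose a M := \sum_(i : 'I_#|A| | enum_val i == M) c i.
have aE i : a (enum_val i) = c i.
  rewrite /a (bigD1 i) //= big1 ?addr0 // => l /andP[/eqP/enum_val_inj -> ].
  by rewrite eqxx.
exists a; last by rewrite [RHS]big_enum_val; apply: eq_bigr => i _; rewrite aE.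
split=> [M|]; first exact: sumr_ge0.
by rewrite big_enum_val -c1; apply: eq_bigr => i _; rewrite aE.
Qed.

Lemma vertex_in M : mx M -> P (vertex M).
Proof.
move=> mxM; exists (fun M' => (M' == M)%:R).
  split=> [M'|]; first exact: ler0n.
  rewrite (bigD1 M) ?inE //= eqxx big1 ?addr0 // => M' /andP[_ /negPf ->] //.
rewrite (bigD1 M) ?inE //= eqxx scale1r big1 ?addr0 // => M' /andP[_ /negPf ->].
by rewrite scale0r.
Qed.

Lemma P_le x e : P x -> dot (w e) x <= h e.
Proof.
move=> [c [c0 c1] ->]; rewrite dot_combr -[leRHS]mul1r -c1 mulr_suml.
apply: ler_sum => M; rewrite inE => mxM; apply: ler_wpM2l => //.
by have [eM|eM] := boolP (e \in M); [rewrite vertexP|rewrite ltW // vertex_lt].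
Qed.

(** * Faces, their labels and their normal cones *)

Definition label S : set V := [set x | P x /\ forall e, e \in S -> dot (w e) x = h e].

Lemma vertex_label M S : mx M -> label S (vertex M) <-> S \subset M.
Proof.
move=> mxM; split=> [[_ H]|sSM].
  apply/fintype.subsetP => e eS; apply: contraT => eM.
  by have := vertex_lt mxM eM; rewrite H // ltxx.
split=> [|e eS]; first exact: vertex_in.
by rewrite vertexP // (fintype.subsetP sSM).
Qed.

Lemma label_neq0 S : dis S -> exists x, label S x.
Proof. by move=> /mx_ext[M mxM /(vertex_label S mxM)]; exists (vertex M). Qed.

(** Complementary slackness: [weight c] bounds the functional on the polytope and is attained on
    [label S], and equality forces every inequality with a positive coefficient to be tight. *)
Lemma max_face_label S c : dis S -> (forall e, 0 <= c e) ->
  (forall e, (e \notin S) = (c e == 0)) -> max_face P (comb c) = label S.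
Proof.
move=> disS c0 cS; have cS' e : e \notin S -> c e = 0 by rewrite cS => /eqP.
have dotE x : dot (comb c) x = \sum_(e in S) c e * dot (w e) x.
  by rewrite (comb_on cS') dot_combl.
have dot_max x : label S x -> dot (comb c) x = weight c.
  by move=> [_ H]; rewrite dotE (weight_on cS'); apply: eq_bigr => e /H ->.
have dot_le x : P x -> dot (comb c) x <= weight c.
  move=> Px; rewrite dotE (weight_on cS'); apply: ler_sum => e _.
  by apply: ler_wpM2l => //; exact: P_le.
apply/seteqP; split=> x.
  move=> [Px maxx]; split=> // e eS; have [z lz] := label_neq0 disS.
  have := maxx z (proj1 lz); rewrite (dot_max z lz) dotE (weight_on cS') => le_sum.
  have le_e : \sum_(f in S) c f * (h f - dot (w f) x) <= 0.
    by under eq_bigr do rewrite mulrBr; rewrite sumrB subr_le0.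
  have ge0 f : f \in S -> 0 <= c f * (h f - dot (w f) x).
    by move=> _; rewrite mulr_ge0 // subr_ge0 P_le.
  have /eqP := le_anti (introT andP (conj le_e (sumr_ge0 _ ge0))).
  rewrite psumr_eq0 // => /allP/(_ e); rewrite mem_index_enum eS /= => /(_ isT).
  rewrite mulf_eq0 subr_eq0 => /orP[|/eqP ->] //.
  by rewrite -cS eS.
by move=> lx; split=> [|y Py]; [case: lx|rewrite (dot_max x lx) dot_le].
Qed.

Lemma max_face_ray e : dis [set e]%SET -> max_face P (w e) = label [set e]%SET.
Proof.
move=> dise; rewrite -comb_delta; apply: max_face_label => // f; rewrite /delta ?ler0n //.
by rewrite finset.in_set1; case: eqP => _; rewrite ?eqxx ?oner_eq0.
Qed.

Lemma face_label S : dis S -> face P (label S).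
Proof.
move=> disS; exists (comb (cutoff S (fun=> 1))).
rewrite (max_face_label disS) // => e; rewrite /cutoff; case: ifP => //.
  by rewrite oner_eq0.
by rewrite eqxx.
Qed.

Lemma label_face F : face P F -> exists2 S, dis S & F = label S.
Proof.
move=> [u ->]; have [S [c [disS c0 cS <- _]]] := representation u.
by exists S; rewrite // (max_face_label disS).
Qed.

(** If a maximal set containing [S] happens to contain [e], flip [e] away. The resulting vertices
    tell labels apart. *)
Lemma mx_avoid S e : dis S -> e \notin S -> exists M, [/\ mx M, S \subset M & e \notin M].
Proof.
move=> /mx_ext[M mxM sSM] eS; have [eM|eM] := boolP (e \in M); last by exists M.
have [M' [mxM' sM eM']] := mx_flip mxM eM; exists M'; split=> //.
apply: fintype.subset_trans sM; apply/fintype.subsetP => f fS.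
rewrite in_setD1 (fintype.subsetP sSM) // andbT.
by apply: contraNneq eS => <-.
Qed.

Lemma label_sub S S' : dis S' -> label S' `<=` label S <-> S \subset S'.
Proof.
move=> disS'; split=> [sub|sub x [Px H]].
  apply/fintype.subsetP => e eS; apply: contraT => /(mx_avoid disS')[M [mxM sM eM]].
  have /sub/(vertex_label _ mxM)/fintype.subsetP/(_ e eS) := (vertex_label _ mxM).2 sM.
  by rewrite (negPf eM).
by split=> // e eS; apply: H; apply: (fintype.subsetP sub).
Qed.

Lemma coneP A y : cone w A y <-> exists2 c, (forall e, 0 <= c e) /\ (forall e, e \notin A -> c e = 0)
  & y = comb c.
Proof.
split=> [[c c0 ->]|[c [c0 cA] ->]].
  exists (cutoff A c); last by rewrite comb_cutoff.
  by split=> [e|]; [rewrite /cutoff; case: ifP|exact: cutoff_out].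
by exists c; rewrite // (comb_on cA).
Qed.

(** If [u] is normal along [label S] and is represented with support S', then [label S] lies in the
    face maximizing [u], which is the label of S'; hence S' is contained in [S]. *)
Lemma normal_cone_label S : dis S -> normal_cone P (label S) = cone w S.
Proof.
move=> disS; apply/seteqP; split=> u.
  move=> uN; have [S' [c [disS' c0 cS' cu _]]] := representation u.
  apply/coneP; exists c => //; split=> // e eS; apply/eqP; rewrite -cS'.
  apply: contra eS; apply: (fintype.subsetP _); apply/(label_sub _ disS).
  rewrite -(max_face_label disS' c0 cS') cu => x lx; split=> [|y Py]; first by case: lx.
  exact: uN.
move=> /coneP[c [c0 cS] ->] x y [Px H] Py.
rewrite (comb_on cS) !dot_combl; apply: ler_sum => e eS; apply: ler_wpM2l => //.
by rewrite H // P_le.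
Qed.

(** * The normal fan *)

Definition fan : set (set V) := normal_fan P.

Lemma fanP C : fan C <-> exists2 S, dis S & C = cone w S.
Proof.
split=> [[F /label_face[S disS ->] ->]|[S disS ->]].
  by exists S; rewrite ?normal_cone_label.
by exists (label S); [exact: face_label|rewrite normal_cone_label].
Qed.

Lemma cone_supp S S' c : dis S -> dis S' -> (forall e, 0 <= c e) ->
  (forall e, e \notin S -> c e = 0) -> cone w S' (comb c) -> forall e, e \notin S' -> c e = 0.
Proof.
move=> disS disS' c0 cS /coneP[c' [c'0 c'S'] cc'] e eS'.
by rewrite (w_uniq disS disS' c0 c'0 cS c'S' cc') c'S'.
Qed.

Lemma cone_sub S S' : dis S -> dis S' -> cone w S `<=` cone w S' <-> S \subset S'.
Proof.
move=> disS disS'; split=> [sub|sub y /coneP[c [c0 cS] ->]].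
  apply/fintype.subsetP => e eS; apply: contraT => eS'.
  have cE f : f \notin S -> delta e f = 0.
    by rewrite /delta; case: eqP => // ->; rewrite eS.
  have := @cone_supp S S' (delta e) disS disS' (fun f => ler0n _ _) cE.
  move=> /(_ _ e eS')/wrap[|/eqP]; last by rewrite /delta eqxx oner_eq0.
  by apply: sub; apply/coneP; exists (delta e); first by split=> // f; exact: ler0n.
apply/coneP; exists c => //; split=> // e eS'; apply: cS; apply: contra eS'.
exact: (fintype.subsetP sub).
Qed.

Lemma cone_ord S : dis S -> exists k (v : 'I_k -> V),
  free [seq v i | i : 'I_k] /\ cone w S = cone v [set: 'I_k]%SET.
Proof.
move=> disS; exists #|S|, (fun i => w (enum_val i)); split.
  have /independent_free := dis_independent disS; congr (is_true (free _)).
  apply: (@eq_from_nth _ 0) => [|i]; first by rewrite size_tuple size_map size_enum_ord.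
  rewrite size_tuple => lt_i; rewrite (nth_map_enum w (Ordinal lt_i)).
  by rewrite (nth_map (Ordinal lt_i)) ?size_enum_ord // (nth_ord_enum _ (Ordinal lt_i)).
apply/seteqP; split=> x [c c0 ->].
  by exists (fun i => c (enum_val i)) => //; rewrite big_enum_val; apply: eq_bigl => i; rewrite inE.
exists (fun e => \sum_(i : 'I_#|S| | enum_val i == e) c i) => [e|]; first exact: sumr_ge0.
rewrite [RHS]big_enum_val; apply: eq_big => [i|i _]; first by rewrite inE.
rewrite [in RHS](bigD1 i) //= big1 ?addr0 // => l /andP[/eqP/enum_val_inj ->].
by rewrite eqxx.
Qed.

Lemma dual_functional_exists S (t : E -> R) : dis S -> exists u, forall e, e \in S -> dot u (w e) = t e.
Proof.
move=> /dis_independent/independent_dual[D DP]; exists (\sum_(f in S) t f *: D f) => e eS.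
rewrite dotC dot_combr (bigD1 e) //= DP // eqxx mulr1 big1 ?addr0 // => f /andP[fS ne].
by rewrite DP // eq_sym (negPf ne) mulr0.
Qed.

Lemma fan_is_fan : is_fan fan.
Proof.
split.
- have -> : fan = [set cone w S | S in [set S | dis S]].
    apply/seteqP; split=> C; first by move=> /fanP[S disS ->]; exists S.
    by move=> [S disS <-]; apply/fanP; exists S.
  exact/finite_image/finite_finset.
- by move=> C /fanP[S /cone_ord[k [v [_ Cv]]] ->]; exists k, v.
- move=> C D /fanP[S disS ->] [u u0 ->]; apply/fanP.
  have ue e : e \in S -> 0 <= dot u (w e).
    move=> eS; apply: u0; apply/coneP; exists (delta e); last by rewrite comb_delta.
    by split=> f; rewrite /delta ?ler0n //; case: eqP => // ->; rewrite eS.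
  exists [set e in S | dot u (w e) == 0]%SET.
    by apply: dis_sub disS; apply/fintype.subsetP => e; rewrite inE => /andP[].
  apply/seteqP; split=> x.
    move=> [/coneP[c [c0 cS] ->] dot0]; apply/coneP; exists c => //; split=> // e.
    rewrite inE negb_and => /orP[/cS //|ne]; have [eS|/cS//] := boolP (e \in S).
    move: dot0; rewrite (comb_on cS) dot_combr => /eqP.
    rewrite psumr_eq0 => [|f fS]; last by rewrite mulr_ge0 ?ue.
    move=> /allP/(_ e); rewrite mem_index_enum eS mulf_eq0 (negPf ne) orbF => /(_ isT).
    by move/eqP.
  move=> /coneP[c [c0 cS] ->].
  have cS' e : e \notin S -> c e = 0 by move=> eS; apply: cS; rewrite inE (negPf eS).
  split; first by apply/coneP; exists c.
  rewrite (comb_on cS') dot_combr big1 // => e eS.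
  have [->|ne] := eqVneq (dot u (w e)) 0; first by rewrite mulr0.
  by rewrite cS ?mul0r // inE eS.
move=> C D /fanP[S disS ->] /fanP[S' disS' ->].
have disI : dis (S :&: S')%SET by apply: dis_sub disS; exact: finset.subsetIl.
(* A supporting functional that is 1 on the rays of [S] outside S' and 0 on the common rays exposes
   the intersection as a face. *)
have [u uP] := dual_functional_exists (fun e => (e \notin S')%:R) disS.
have dotu c : (forall e, e \notin S -> c e = 0) ->
    dot u (comb c) = \sum_(e in S) c e * (e \notin S')%:R.
  by move=> cS; rewrite (comb_on cS) dot_combr; apply: eq_bigr => e eS; rewrite uP.
exists u.
  move=> x /coneP[c [c0 cS] ->]; rewrite dotu //.
  by apply: sumr_ge0 => e _; rewrite mulr_ge0.
apply/seteqP; split=> x.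
  move=> [Cx Dx]; split=> //; move: Cx Dx => /coneP[c [c0 cS] ->] Dx; rewrite dotu // big1 // => e eS.
  have [eS'|eS'] := boolP (e \in S'); first by rewrite mulr0.
  by rewrite (cone_supp disS disS' c0 cS Dx) // mul0r.
move=> [Cx]; split=> //; move: Cx b => /coneP[c [c0 cS] ->].
rewrite dotu // => /eqP; rewrite psumr_eq0 => [|e _]; last by rewrite mulr_ge0.
move=> /allP sum0; apply/coneP; exists c => //; split=> // e eS'.
have [eS|/cS//] := boolP (e \in S).
have := sum0 e; rewrite mem_index_enum eS eS' mulr1 => /(_ isT).
by move/eqP.
Qed.

Lemma fan_complete : complete_fan fan.
Proof.
move=> y; have [S [c [disS c0 cS cy _]]] := representation y.
exists (cone w S); first by apply/fanP; exists S.
by apply/coneP; exists c => //; split=> // e; rewrite cS => /eqP.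
Qed.

Lemma fan_simplicial : simplicial_fan fan.
Proof. by move=> C /fanP[S disS ->]; exact: cone_ord. Qed.

Lemma mx_max M S : mx M -> dis S -> M \subset S -> S = M.
Proof.
move=> mxM /mx_ext[M' mxM' sSM'] sMS; apply/eqP; rewrite eq_sym finset.eqEcard sMS.
by rewrite (mx_card mxM) -(mx_card mxM') subset_leq_card.
Qed.

Lemma fan_max_cones : max_cones fan = [set C | exists2 M, mx M & C = cone w M].
Proof.
apply/seteqP; split=> C.
  move=> [/fanP[S disS ->] maxS]; have [M mxM sSM] := mx_ext disS.
  exists M => //; apply/esym/maxS; first by apply/fanP; exists M => //; exact: mx_dis.
  by apply/cone_sub => //; exact: mx_dis.
move=> [M mxM ->]; split; first by apply/fanP; exists M => //; exact: mx_dis.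
move=> D /fanP[S disS ->] /(cone_sub (mx_dis mxM) disS) sMS.
by rewrite (mx_max mxM disS sMS).
Qed.

(** * Directions of faces: dimension and parallelism *)

Lemma dual_expand M D z : mx M ->
  (forall e f, e \in M -> f \in M -> dot (w e) (D f) = (e == f)%:R) ->
  z = \sum_(f in M) dot (w f) z *: D f.
Proof.
move=> mxM DP; set z' := \sum_(f in M) _; apply/subr0_eq.
have orth e : e \in M -> dot (w e) (z - z') = 0.
  move=> eM; rewrite dotBr dot_combr (bigD1 e) //= DP // eqxx mulr1 big1 ?addr0 ?subrr //.
  by move=> f /andP[fM ne]; rewrite DP // eq_sym (negPf ne) mulr0.
have orth_all y : dot y (z - z') = 0.
  have [a ->] := mx_span mxM y; rewrite dot_combl big1 // => e /orth ->.
  by rewrite mulr0.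
apply/ffunP => j; rewrite [RHS]ffunE.
have := orth_all [ffun k => (k == j)%:R].
rewrite /dot (bigD1 j) //= big1 => [|k ne]; first by rewrite [X in X * _]ffunE eqxx mul1r addr0.
by rewrite [X in X * _]ffunE (negPf ne) mul0r.
Qed.

(** The direction is the orthogonal complement of the rays of [S], spanned by the dual vectors of
    the rays of [M] outside [S]. Each of these is, up to scale, the edge of the polytope from
    [vertex M] to the vertex obtained by flipping that ray. *)
Lemma label_direction S : dis S -> exists U : {vspace V},
  [/\ is_direction (label S) U, \dim U = (#|J| - #|S|)%N &
      forall z, z \in U <-> forall e, e \in S -> dot (w e) z = 0].
Proof.
move=> disS; have [M mxM sSM] := mx_ext disS; have [D DP] := mx_dual mxM.
have sM f : f \in (M :\: S)%SET -> f \in M by rewrite inE => /andP[].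
have indD : independent D (M :\: S)%SET.
  move=> a sum0 e eA; have := congr1 (dot (w e)) sum0.
  rewrite dot0r dot_combr (bigD1 e) //= DP ?sM // eqxx mulr1 big1 ?addr0 // => f /andP[fA ne].
  by rewrite DP ?sM // eq_sym (negPf ne) mulr0.
pose X := map_tuple D (enum_tuple (M :\: S)%SET).
have DU f : f \in (M :\: S)%SET -> D f \in <<X>>%VS.
  by move=> fA; apply/memv_span/map_f; rewrite mem_enum.
have inU z : (forall e, e \in S -> dot (w e) z = 0) -> z \in <<X>>%VS.
  move=> z0; rewrite (dual_expand z mxM DP); apply: memv_suml => f fM.
  have [/z0 ->|fS] := boolP (f \in S); first by rewrite scale0r mem0v.
  by apply/memvZ/DU; rewrite inE fS.
have Uin z : z \in <<X>>%VS -> forall e, e \in S -> dot (w e) z = 0.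
  move=> zU e eS; rewrite (coord_span zU) dot_combr big1 // => i _.
  have := enum_valP i; rewrite inE => /andP[iS iM].
  rewrite nth_map_enum (DP _ _ (fintype.subsetP sSM _ eS) iM).
  by case: eqP => [ei|]; [rewrite -ei eS in iS|rewrite mulr0].
pose U := <<X>>%VS; exists U; split.
- split=> [x y [_ Hx] [_ Hy]|U' HU'].
    by apply: inU => e eS; rewrite dotBr Hx ?Hy ?subrr.
  apply/span_subvP => x /mapP[f]; rewrite mem_enum => fA ->; have fM := sM f fA.
  have [M' [mxM' sM' fM']] := mx_flip mxM fM.
  have sSM' : S \subset M'.
    apply: fintype.subset_trans sM'; apply/fintype.subsetP => e eS.
    rewrite in_setD1 (fintype.subsetP sSM) // andbT; apply: contraTneq fA => <-.
    by rewrite inE eS.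
  have := HU' _ _ ((vertex_label _ mxM').2 sSM') ((vertex_label _ mxM).2 sSM).
  rewrite (dual_expand (_ - _) mxM DP) (bigD1 f) //= big1 => [|e /andP[eM ne]].
    rewrite addr0 dotBr (vertexP mxM fM).
    have neg : dot (w f) (vertex M') - h f != 0.
      by rewrite subr_eq0 lt_eqF // vertex_lt.
    by move=> /(memvZ (dot (w f) (vertex M') - h f)^-1); rewrite scalerA mulVf // scale1r.
  rewrite dotBr (vertexP mxM eM) vertexP ?subrr ?scale0r //.
  by rewrite (fintype.subsetP sM') // in_setD1 ne.
- move/independent_free: indD => /eqP ->.
  by rewrite size_tuple cardsD (finset.setIidPr sSM) (mx_card mxM).
- by move=> z; split; [exact: Uin|exact: inU].
Qed.

Lemma direction_uniq (F : set V) (U U' : {vspace V}) :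
  is_direction F U -> is_direction F U' -> U = U'.
Proof.
move=> [FU minU] [FU' minU']; apply/eqP; rewrite eqEsubv.
by rewrite minU // minU'.
Qed.

Lemma affine_dim_label S d : dis S -> affine_dim (label S) d <-> d = (#|J| - #|S|)%N.
Proof.
move=> /label_direction[U [dirU dimU _]]; split=> [[U' dirU' <-]|->]; last by exists U.
by rewrite (direction_uniq dirU' dirU).
Qed.

Lemma label0 : label finset.set0 = P.
Proof. by apply/seteqP; split=> x; [case|split=> // e; rewrite inE]. Qed.

Lemma dis_card S : dis S -> (#|S| <= #|J|)%N.
Proof. by move=> /mx_ext[M /mx_card <- /subset_leq_card]. Qed.

Lemma facet_label G : dis finset.set0 ->
  facet P G <-> exists2 e, dis [set e]%SET & G = max_face P (w e).
Proof.
move=> dis0; have dimP d : affine_dim P d <-> d = #|J|.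
  by rewrite -label0 affine_dim_label // cards0 subn0.
split=> [[/label_face[S disS ->] [d /dimP dJ /(affine_dim_label _ disS) dS]]|[e dise ->]].
  (* [dis_card] rules out truncation in the subtraction [#|J| - #|S|]. *)
  have : #|S| == 1%N by have := dis_card disS; lia.
  by move=> /cards1P[e eS]; exists e; rewrite ?max_face_ray -?eS.
rewrite max_face_ray //; split; first exact: face_label.
have := dis_card dise; rewrite cards1 => J1.
exists #|J|.-1; first by apply/dimP; rewrite prednK.
by apply/affine_dim_label => //; rewrite cards1 subn1.
Qed.

(** Every dual basis vector [D g] with g different from [e] is a direction of the facet of [e],
    hence of that of [f], so it is orthogonal to [w f]; only the coordinate of [w f] at [e] can
    survive. *)
Lemma parallel_ray e f : dis [set e]%SET -> dis [set f]%SET ->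
  parallel (max_face P (w e)) (max_face P (w f)) -> exists a, w f = a *: w e.
Proof.
move=> dise disf; rewrite !max_face_ray // => -[U dir_e dir_f].
have [Ue [dirUe _ memUe]] := label_direction dise.
have [Uf [dirUf _ memUf]] := label_direction disf.
have [M mxM seM] := mx_ext dise; have [D DP] := mx_dual mxM.
have eM : e \in M by rewrite (fintype.subsetP seM) // finset.in_set1.
have [a wf] := mx_span mxM (w f).
have af g : g \in M -> g != e -> a g = 0.
  move=> gM ge.
  have : D g \in Uf.
    rewrite (direction_uniq dirUf dir_f) -(direction_uniq dirUe dir_e); apply/memUe => e'.
    by rewrite finset.in_set1 => /eqP ->; rewrite DP // eq_sym (negPf ge).
  move=> /memUf/(_ f); rewrite finset.in_set1 eqxx wf => /(_ isT).
  rewrite dot_combl (bigD1 g) //= DP // eqxx mulr1 big1 ?addr0 // => g' /andP[g'M ne].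
  by rewrite DP // (negPf ne) mulr0.
exists (a e); rewrite wf (bigD1 e) //= big1 ?addr0 // => g /andP[gM ge].
by rewrite af // scale0r.
Qed.

Lemma ray_parallel e f : dis [set e]%SET -> dis [set f]%SET -> w f = - w e ->
  parallel (max_face P (w e)) (max_face P (w f)).
Proof.
move=> dise disf wf; rewrite !max_face_ray //.
have [Ue [dirUe _ memUe]] := label_direction dise.
have [Uf [dirUf _ memUf]] := label_direction disf.
exists Ue => //; suff -> : Ue = Uf by [].
have dotN z : dot (w f) z = - dot (w e) z by rewrite wf dotC dotNr dotC.
apply/vspaceP => z; apply/idP/idP => [/memUe H|/memUf H].
  by apply/memUf => g; rewrite finset.in_set1 => /eqP ->; rewrite dotN H ?oppr0 ?finset.in_set1.
apply/memUe => g; rewrite finset.in_set1 => /eqP ->; apply/eqP.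
by rewrite -oppr_eq0 -dotN H ?finset.in_set1.
Qed.

Lemma ray_face_label S : dis S ->
  [set x | P x /\ forall e, e \in S -> max_face P (w e) x] = label S.
Proof.
move=> disS; have dise e : e \in S -> dis [set e]%SET.
  by move=> eS; apply: dis_sub disS; rewrite finset.sub1set.
apply/seteqP; split=> x [Px H]; split=> // e eS.
  by have := H e eS; rewrite max_face_ray ?dise // => -[_]; apply; rewrite finset.in_set1.
rewrite max_face_ray ?dise //; split=> // f; rewrite finset.in_set1 => /eqP ->.
exact: H.
Qed.

Theorem polytopal_fan : dis finset.set0 -> exists P : set V,
  let lab S := [set x | P x /\ forall e, e \in S -> max_face P (w e) x] in
  [/\ polytope P,
      [/\ is_fan (normal_fan P), complete_fan (normal_fan P), simplicial_fan (normal_fan P)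
        & max_cones (normal_fan P) = [set C | exists2 M, mx M & C = cone w M]],
      [/\ affine_dim P #|J|, forall S, dis S -> face P (lab S),
          forall F, face P F -> exists2 S, dis S & F = lab S,
          forall S S', dis S -> dis S' -> (lab S' `<=` lab S <-> S \subset S')
        & forall S, dis S -> normal_cone P (lab S) = cone w S],
      forall G, facet P G <-> exists2 e, dis [set e]%SET & G = max_face P (w e)
    & (forall e f, dis [set e]%SET -> dis [set f]%SET ->
        parallel (max_face P (w e)) (max_face P (w f)) -> exists a, w f = a *: w e) /\
      (forall e f, dis [set e]%SET -> dis [set f]%SET -> w f = - w e ->
        parallel (max_face P (w e)) (max_face P (w f)))].
Proof.
move=> dis0; exists P; split.
- exact: fan_polytope_polytope.
- split; [exact: fan_is_fan|exact: fan_complete|exact: fan_simplicial|exact: fan_max_cones].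
- split.
  + by rewrite -label0; apply/affine_dim_label; rewrite ?cards0 ?subn0.
  + by move=> S disS; rewrite ray_face_label //; exact: face_label.
  + by move=> F /label_face[S disS ->]; exists S; rewrite ?ray_face_label.
  + by move=> S S' disS disS'; rewrite !ray_face_label //; exact: label_sub.
  + by move=> S disS; rewrite ray_face_label //; exact: normal_cone_label.
- by move=> G; exact: facet_label.
- by split=> e f; [exact: parallel_ray|exact: ray_parallel].
Qed.

End PolytopalFan.

(** * The projection to the seed *)

Section Complex.
Variable n : nat.
Hypothesis n_ge4 : (4 <= n)%N.
Implicit Types (e : edge n) (S M : {set edge n}).

Definition mx_dissection M : bool :=
  [exists T : {set edge n}, triangulation T && (M == diagonals T)].

Lemma mx_dissectionP M :
  reflect (exists2 T, triangulation T & M = diagonals T) (mx_dissection M).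
Proof.
apply: (iffP existsP) => [[T /andP[triT /eqP ->]]|[T triT ->]]; exists T => //.
by rewrite triT eqxx.
Qed.

Lemma dissection0 : dissection (finset.set0 : {set edge n}).
Proof.
by apply/andP; split; [apply/noncrossingP|apply/forall_inP] => e; rewrite inE.
Qed.

Lemma dissection1 e : dissection [set e]%SET = ~~ boundary e.
Proof.
apply/idP/idP => [/dissection_nb|nbe]; first by apply; rewrite finset.in_set1.
apply/andP; split; last by apply/forall_inP => f; rewrite finset.in_set1 => /eqP ->.
apply/noncrossingP => f g; rewrite !finset.in_set1 => /eqP -> /eqP ->.
by rewrite crossee.
Qed.

End Complex.

Section Projection.
Variables (R : realType) (n : nat) (n_ge4 : (4 <= n)%N).
Variables (T : {set edge n}) (T_triang : triangulation T).
Variable phi : {linear {ffun {e : edge n | e \in T} -> R^o}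
                -> {ffun {e : edge n | e \in diagonals T} -> R^o}}.
Hypothesis phi_ker : forall x, phi x = 0 <->
       exists2 v, v \in lineality R n & x = keep_coords T v.
Implicit Types (e f g : edge n) (S : {set edge n}) (v : {ffun edge n -> R^o}).

Definition seed_proj v := phi (keep_coords T v).
Definition ray e := seed_proj (Wdiag R e).
Local Notation J := {e : edge n | e \in diagonals T}.

Lemma seed_proj_sum (I : finType) (c : I -> R) (F : I -> {ffun edge n -> R^o}) :
  seed_proj (\sum_i c i *: F i) = \sum_i c i *: seed_proj (F i).
Proof.
rewrite /seed_proj; have -> : keep_coords T (\sum_i c i *: F i) = \sum_i c i *: keep_coords T (F i).
  apply/ffunP => e; rewrite ffunE !sum_ffunE; apply: eq_bigr => i _.
  by rewrite !ffunE.
by rewrite linear_sum; apply: eq_bigr => i _; rewrite linearZ.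
Qed.

Lemma seed_projD v v' : seed_proj (v + v') = seed_proj v + seed_proj v'.
Proof.
by rewrite /seed_proj -linearD; congr (phi _); apply/ffunP => e; rewrite !ffunE.
Qed.

Lemma seed_proj0 : seed_proj 0 = 0.
Proof.
by rewrite -[RHS](linear0 phi) /seed_proj; congr (phi _); apply/ffunP => e; rewrite !ffunE.
Qed.

Lemma seed_proj_eqmod v v' : seed_proj v = seed_proj v' <-> eqmod T v v'.
Proof.
rewrite /seed_proj; split=> [E|[l lL H]].
  have /phi_ker[l lL H] : phi (keep_coords T v - keep_coords T v') = 0 by rewrite linearB E subrr.
  exists l => // e eT; have := congr1 (fun x : {ffun {e | e \in T} -> R^o} => x (exist _ e eT)) H.
  by rewrite !ffunE /= => <-; rewrite addrC subrK.
apply/subr0_eq; rewrite -linearB; apply/phi_ker; exists l => //.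
by apply/ffunP => -[e eT]; rewrite !ffunE /= (H e eT) addrC addKr.
Qed.

Lemma comb_ray c : comb ray c = seed_proj (\sum_e c e *: Wdiag R e).
Proof. by rewrite seed_proj_sum. Qed.

Lemma ray_boundary e : boundary e -> ray e = 0.
Proof.
move=> be; rewrite -seed_proj0; apply/seed_proj_eqmod; exists (Wdiag R e); first exact: boundary_L.
by move=> f _; rewrite [X in _ = X + _]ffunE add0r.
Qed.

Lemma eqmod_rays e f : eqmod T (Wdiag R e + Wdiag R f) 0 -> ray f = - ray e.
Proof.
move=> /seed_proj_eqmod; rewrite seed_projD seed_proj0.
by rewrite addrC => /eqP; rewrite addr_eq0 => /eqP.
Qed.

Lemma ray_rotate e : e \in diagonals T -> ray (rotate e) = - ray e.
Proof.
by rewrite diagonalsP => /andP[eT nbe]; apply/eqmod_rays/rotate_opposite.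
Qed.

Lemma ray_uniq S S' (c c' : edge n -> R) : dissection S -> dissection S' ->
  (forall e, 0 <= c e) -> (forall e, 0 <= c' e) ->
  (forall e, e \notin S -> c e = 0) -> (forall e, e \notin S' -> c' e = 0) ->
  comb ray c = comb ray c' -> c =1 c'.
Proof.
move=> dS dS' c0 c'0 cS c'S'; rewrite !comb_ray => /seed_proj_eqmod.
exact: (combination_uniq n_ge4 T_triang dS dS' c0 c'0 cS c'S').
Qed.

(** There are two ways not to be a dissection. A side of the polygon has ray zero but positive cost,
    so it is traded, taken twice, for the empty combination; a crossing pair is traded by
    [exchange]. *)
Lemma ray_exchange S : ~~ dissection S -> exists e f (g : edge n -> R),
  [/\ e \in S, f \in S, forall k, 0 <= g k, comb ray g = ray e + ray f
    & weight (@cost R n) g < cost R e + cost R f].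
Proof.
rewrite negb_and => /orP[|/forall_inPn[e eS]]; last first.
  rewrite negbK => be; exists e, e, (fun=> 0); split=> //.
    by rewrite ray_boundary // addr0 /comb big1 // => f _; rewrite scale0r.
  rewrite /weight big1 => [|f _]; last by rewrite mul0r.
  by rewrite addr_gt0 ?cost_gt0.
move=> /forall_inPn[e eS] /forall_inPn[f fS]; rewrite negbK => cef.
have [g [h [eq_gh lt_cost]]] := exchange R n_ge4 T_triang cef.
exists e, f, (fun k => 1 * delta R g k + 1 * delta R h k); split=> //.
- by move=> k; rewrite !mul1r addr_ge0 ?ler0n.
- rewrite comb_lin !comb_delta !scale1r -!seed_projD; apply/seed_proj_eqmod.
  by exists 0; rewrite ?mem0v // => p /eq_gh; rewrite !ffunE addr0.
- by rewrite weight_lin !weight_delta !mul1r.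
Qed.

(** The cross-ratio on the quadrilateral of [e] is well defined on the quotient; dividing by -2
    normalizes its value at [e] to 1. *)
Lemma dual_form e : e \in diagonals T -> exists Y : {ffun J -> R^o} -> R,
  [/\ forall (c : edge n -> R), Y (comb ray c) = \sum_f c f * Y (ray f),
      forall f, f \in diagonals T -> Y (ray f) = (f == e)%:R
    & forall f, Y (ray f) \in [:: 0; 1; -1]].
Proof.
rewrite diagonalsP => /andP[eT nbe].
have [a [b [c [d [ap inv vals dual]]]]] := dual_functional R n_ge4 T_triang eT nbe.
(* A choice of preimages, with default 0 off the image; [inv] makes the value on the image
   independent of the choice. *)
have pre y : {v | (exists v', seed_proj v' = y) -> seed_proj v = y}.
  apply: cid; have [[v' E]|no] := pselect (exists v', seed_proj v' = y); first by exists v'.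
  by exists 0.
pose Y y := - crossratio (sval (pre y)) a b c d / 2.
have YE v : Y (seed_proj v) = - crossratio v a b c d / 2.
  rewrite /Y (inv _ v) //; apply/seed_proj_eqmod.
  by apply: (svalP (pre _)); exists v.
exists Y; split.
- move=> k; rewrite comb_ray YE crossratio_lin // -sumrN mulr_suml.
  by apply: eq_bigr => f _; rewrite YE mulrA mulrN.
- by move=> f; rewrite diagonalsP => /andP[fT _]; rewrite YE dual //; field.
- have div2 : 2 / 2 = 1 :> R by rewrite divff // pnatr_eq0.
  move=> f; rewrite YE; have := vals f; rewrite !inE => /or3P[]/eqP ->.
  + by rewrite oppr0 mul0r eqxx.
  + by rewrite mulNr div2 eqxx !orbT.
  + by rewrite opprK div2 eqxx !orbT.
Qed.

Lemma card_J : #|{: J}| = (n - 3)%N.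
Proof. by rewrite card_sig -(card_diagonals n_ge4 T_triang); apply: eq_card => e. Qed.

Lemma ray_independent S : dissection S -> independent ray S.
Proof. exact: (dis_independent ray_uniq). Qed.

(** The rays of the seed diagonals form a basis, by independence and counting, and the negative of
    each is the ray of its rotation. *)
Lemma ray_span y : exists2 c : edge n -> R, (forall e, 0 <= c e) & comb ray c = y.
Proof.
have [|a ->] := independent_span (ray_independent (dissection_diagonals T_triang)) _ y.
  by rewrite card_J card_diagonals.
apply: (big_ind (fun y => exists2 c : edge n -> R, (forall e, 0 <= c e) & comb ray c = y)).
- by exists (fun=> 0) => //; rewrite /comb big1 // => e _; rewrite scale0r.
- move=> x z [c c0 <-] [c' c'0 <-]; exists (fun e => 1 * c e + 1 * c' e).
    by move=> e; rewrite !mul1r addr_ge0.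
  by rewrite comb_lin !scale1r.
- move=> e eT; have [a0|a0] := leP 0 (a e).
    exists (fun f => a e * delta R e f + 0 * 0) => [f|].
      by rewrite mul0r addr0 mulr_ge0 // ler0n.
    by rewrite (comb_lin _ _ _ _ (fun=> 0)) comb_delta scale0r addr0.
  exists (fun f => - a e * delta R (rotate e) f + 0 * 0) => [f|].
    by rewrite mul0r addr0 mulr_ge0 ?ler0n // oppr_ge0 ltW.
  by rewrite (comb_lin _ _ _ _ (fun=> 0)) comb_delta scale0r addr0 ray_rotate // scalerN scaleNr opprK.
Qed.

Lemma ray_coord (i : 'I_#|diagonals T|) e :
  coord (map_tuple ray (enum_tuple (diagonals T))) i (ray e) \in [:: 0; 1; -1].
Proof.
have [Y [Ylin Ydual Yvals]] := dual_form (enum_valP i).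
have ind := ray_independent (dissection_diagonals T_triang).
have [|a ray_e] := independent_span ind _ (ray e); first by rewrite card_J card_diagonals.
set X := map_tuple _ _.
have -> : coord X i (ray e) = a (enum_val i).
  rewrite ray_e big_enum_val linear_sum (bigD1 i) //= big1 => [|j ne].
    rewrite addr0 linearZ /= -nth_map_enum coord_free ?eqxx ?mulr1 //.
    exact/independent_free.
  rewrite linearZ /= -nth_map_enum coord_free ?(negPf ne) ?mulr0 //.
  exact/independent_free.
have : Y (ray e) = a (enum_val i); last by move=> <-; exact: Yvals.
rewrite ray_e -comb_cutoff Ylin (bigD1 (enum_val i)) //= /cutoff enum_valP.
rewrite Ydual ?enum_valP // eqxx mulr1 big1 ?addr0 // => f ne.
by case: ifP => fT; [rewrite Ydual // (negPf ne) mulr0|rewrite mul0r].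
Qed.

(** Otherwise zero would have, besides the empty representation, one supported on the diagonals
    among [e] and [f], which form a dissection. *)
Lemma opposite_noncrossing e f : ~~ cross e f -> ray e + ray f = 0 -> boundary e.
Proof.
move=> ncef sum0; apply: contraT => nbe.
pose S := [set k in [set e; f]%SET | ~~ boundary k]%SET.
have disS : dissection S.
  apply/andP; split; last by apply/forall_inP => k; rewrite !inE => /andP[].
  apply/noncrossingP => k l; rewrite !inE.
  by move=> /andP[/orP[]/eqP-> _] /andP[/orP[]/eqP-> _]; rewrite ?crossee // crossC.
pose c k : R := cutoff S (fun k => 1 * delta R e k + 1 * delta R f k) k.
have c0 k : 0 <= c k.
  by rewrite /c /cutoff; case: ifP => // _; rewrite !mul1r addr_ge0 ?ler0n.
have combc : comb ray c = comb ray (fun=> 0).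
  rewrite [RHS]big1 => [|k _]; last by rewrite scale0r.
  rewrite -sum0 -[ray e](comb_delta ray) -[ray f](comb_delta ray).
  rewrite -[in RHS](scale1r (comb ray (delta R e))) -[in RHS](scale1r (comb ray (delta R f))).
  rewrite -comb_lin.
  apply: eq_bigr => k _; rewrite /c /cutoff; case: ifPn => //.
  rewrite inE negb_and negbK !inE negb_or => /orP[/andP[ke kf]|bk].
    by rewrite /delta (negPf ke) (negPf kf) !mulr0 addr0.
  by rewrite ray_boundary // !scaler0.
have := ray_uniq disS (dissection0 n) c0 (fun=> lexx 0) (@cutoff_out _ _ S _) (fun _ _ => erefl) combc e.
rewrite /c /cutoff !inE eqxx nbe /= /delta eqxx mulr1 mul1r => /eqP.
by rewrite paddr_eq0 ?ler0n // oner_eq0.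
Qed.

Lemma ray_neq0 e : ~~ boundary e -> ray e != 0.
Proof.
move=> nbe; apply: contraNneq nbe => ray0.
by apply: (@opposite_noncrossing e e); rewrite ?crossee // ray0 addr0.
Qed.

(** Opposite rays of diagonals must cross; resolving the crossing yields non-crossing [g] and [h],
    again with sum zero, which are therefore sides of the polygon. *)
Lemma ray_opposite e f : ~~ boundary e -> ~~ boundary f -> ray f = - ray e ->
  (e \in diagonals T /\ f = rotate e) \/ (f \in diagonals T /\ e = rotate f).
Proof.
move=> nbe nbf opp; have sum0 : ray e + ray f = 0 by rewrite opp subrr.
have [cef|ncef] := boolP (cross e f); last first.
  by have := opposite_noncrossing ncef sum0; rewrite (negPf nbe).
have [g [h [eq_gh [ncgh rot]]]] := resolve_boundary R n_ge4 T_triang cef nbe nbf.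
have sum_gh : ray g + ray h = 0.
  rewrite -sum0 -!seed_projD; apply/esym/seed_proj_eqmod.
  by exists 0; rewrite ?mem0v // => p /eq_gh; rewrite !ffunE addr0.
have bg := opposite_noncrossing ncgh sum_gh.
rewrite crossC addrC in ncgh sum_gh; have bh := opposite_noncrossing ncgh sum_gh.
by rewrite !diagonalsP nbe nbf !andbT; exact: rot.
Qed.

(** A positive factor contradicts uniqueness of representations. Some dual form is nonzero on
    [ray e], hence on [ray f], and takes values 1 or -1 there, so the factor has absolute value
    1. *)
Lemma ray_proportional e f a : ~~ boundary e -> ~~ boundary f -> e != f ->
  ray f = a *: ray e -> ray f = - ray e.
Proof.
move=> nbe nbf ef ray_f.
have a_le0 : a <= 0.
  rewrite leNgt; apply/negP => a0.
  pose c k := a * delta R e k + 0 * 0.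
  have combc : comb ray c = comb ray (delta R f).
    by rewrite (comb_lin _ _ _ _ (fun=> 0)) !comb_delta scale0r addr0.
  have dis1 (k : edge n) : ~~ boundary k -> dissection [set k]%SET by rewrite dissection1.
  have c0 k : 0 <= c k by rewrite /c mul0r addr0 mulr_ge0 ?ler0n // ltW.
  have cS k : k \notin [set e]%SET -> c k = 0.
    by rewrite finset.in_set1 /c /delta => /negPf ->; rewrite mulr0 mul0r addr0.
  have dS k : k \notin [set f]%SET -> delta R f k = 0.
    by rewrite finset.in_set1 /delta => /negPf ->.
  have := ray_uniq (dis1 e nbe) (dis1 f nbf) c0 (fun=> ler0n _ _) cS dS combc f.
  rewrite /c /delta eqxx eq_sym (negPf ef) mulr0 mul0r addr0 => /eqP.
  by rewrite eq_sym oner_eq0.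
have [|b ray_e] := independent_span (ray_independent (dissection_diagonals T_triang)) _ (ray e).
  by rewrite card_J card_diagonals.
have [d dT bd] : exists2 d, d \in diagonals T & b d != 0.
  apply: contrapT => H; move/negP: (ray_neq0 nbe); apply.
  rewrite ray_e big1 // => d dT; have [->|bd] := eqVneq (b d) 0; first by rewrite scale0r.
  by case: H; exists d.
have [Y [Ylin Ydual Yvals]] := dual_form dT.
have Ye : Y (ray e) != 0.
  rewrite ray_e -comb_cutoff Ylin (bigD1 d) //= /cutoff dT Ydual // eqxx mulr1.
  rewrite big1 ?addr0 // => k ne; case: ifP => kT; last by rewrite mul0r.
  by rewrite Ydual // (negPf ne) mulr0.
have Yf : Y (ray f) = a * Y (ray e).
  rewrite ray_f -[in LHS](comb_delta ray e) -[LHS]/(Y _).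
  have -> : a *: comb ray (delta R e) = comb ray (fun k => a * delta R e k + 0 * 0).
    by rewrite (comb_lin _ _ _ _ (fun=> 0)) scale0r addr0.
  rewrite Ylin (bigD1 e) //= /delta eqxx mulr1 mul0r addr0 big1 ?addr0 // => k ne.
  by rewrite (negPf ne) mulr0 add0r mul0r.
have a0 : a != 0.
  by apply: contraNneq (ray_neq0 nbf) => a0; rewrite ray_f a0 scale0r.
suff a1 : a = -1 by rewrite ray_f a1 scaleN1r.
have := Yvals f; have := Yvals e; rewrite Yf !inE (negPf Ye) mulf_eq0 (negPf a0) (negPf Ye) /=.
by move=> /orP[]/eqP -> /orP[]/eqP; rewrite ?mulr1 ?mulrN1; lra.
Qed.

End Projection.

Theorem theorem1p12 (R : realType) (n : nat) (n_ge4 : (4 <= n)%N)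
    (T : {set edge n}) (T_triang : triangulation T)
    (phi : {linear {ffun {e : edge n | e \in T} -> R^o}
                -> {ffun {e : edge n | e \in diagonals T} -> R^o}})
    (phi_surj : forall y, exists x, phi x = y)
    (phi_ker : forall x, phi x = 0 <->
       exists2 v, v \in lineality R n & x = keep_coords T v) :
  let proj := fun v : {ffun edge n -> R^o} => phi (keep_coords T v) in
  let Wbar := fun e : edge n => proj (W R (lo e) (hi e)) in
  [/\ #|diagonals T| = (n - 3)%N,
      (* proj identifies Pf1plus modulo its lineality space with the whole
         space, and its maximal cones with the cones on the Wbar *)
      [/\ forall y, exists2 v, Pf1plus v & proj v = y,
          forall v w, Pf1plus v -> Pf1plus w -> proj v = proj w ->
            v - w \in lineality R n
        & forall T', triangulation T' ->
            Pf_cone T' `<=` @Pf1plus R n /\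
            proj @` Pf_cone T' = cone Wbar (diagonals T')],
      exists Fan : set (set {ffun {e : edge n | e \in diagonals T} -> R^o}),
        [/\ is_fan Fan, complete_fan Fan, simplicial_fan Fan,
            max_cones Fan =
              [set C | exists2 T', triangulation T' & C = cone Wbar (diagonals T')]
          & exists P : set {ffun {e : edge n | e \in diagonals T} -> R^o},
              [/\ polytope P,
                  Fan = normal_fan P,
                  realizes_associahedron P (dissection_face P Wbar) /\
                  (forall S, dissection S ->
                     normal_cone P (dissection_face P Wbar S) = cone Wbar S),
                  forall G, facet P G <->
                    exists2 e, ~~ boundary e & G = max_face P (Wbar e)
                & #|parallel_pairs P Wbar| = (n - 3)%N /\
                  parallel_pairs P Wbar =
                    [set [set e; rotate e] | e in diagonals T]%SET]]
    & let B := map_tuple Wbar (enum_tuple (diagonals T)) in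
      basis_of fullv B /\
      forall e, ~~ boundary e -> e \notin T ->
        forall i, coord B i (Wbar e) \in [:: 0; 1; -1]].
Proof.
move=> proj Wbar.
have uniq := @ray_uniq R n n_ge4 T T_triang phi phi_ker.
have cardJ := card_J n_ge4 T_triang.
have ind S : dissection S -> independent Wbar S by exact: (dis_independent uniq).
have mxP (M : {set edge n}) : mx_dissection M -> dissection M.
  by move=> /mx_dissectionP[T' triT' ->]; exact: dissection_diagonals.
have mx_ext S : dissection S -> exists2 M : {set edge n}, mx_dissection M & S \subset M.
  move=> /dissection_ext[T' triT' sS]; exists (diagonals T') => //.
  by apply/mx_dissectionP; exists T'.
have mx_card (M : {set edge n}) : mx_dissection M -> #|M| = #|{: {e : edge n | e \in diagonals T}}|.
  by move=> /mx_dissectionP[T' triT' ->]; rewrite cardJ card_diagonals.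
have mx_flip (M : {set edge n}) e : mx_dissection M -> e \in M ->
    exists M', [/\ mx_dissection M', (M :\ e)%SET \subset M' & e \notin M'].
  move=> /mx_dissectionP[T1 triT1 ->] eT1; have [T2 [triT2 sub nin]] := flip triT1 eT1.
  by exists (diagonals T2); split=> //; apply/mx_dissectionP; exists T2.
have span := @ray_span R n n_ge4 T T_triang phi phi_ker.
have exch := @ray_exchange R n n_ge4 T T_triang phi phi_ker.
(* The rays are indexed by all edges: sides of the polygon give zero rays of positive cost and
   belong to no dissection. *)
have [P [polyP [fanP complP simplP maxP] [dimP faceP labelP subP ncP] facP [parP1 parP2]]] :=
  @polytopal_fan R _ (edge n) Wbar (@cost R n) (@dissection n) (@mx_dissection n)
    (cost_gt0 R (n:=n)) (@dissection_sub n) mxP mx_ext mx_card mx_flip span exch uniq (dissection0 n).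
split.
- exact: card_diagonals.
- split.
  + move=> y; have [C [F /labelP[S disS ->] ->]] := complP y; rewrite ncP // => /coneP[c [c0 cS] ->].
    exists (\sum_e c e *: Wdiag R e); last by rewrite [RHS]comb_ray.
    rewrite -[X in Pf1plus X]add0r.
    by apply: (dissection_combination_Pf n_ge4 _ disS) => //; exact: mem0v.
  + by move=> v w Pv Pw /(seed_proj_eqmod phi_ker); exact: (Pf_eqmod n_ge4 T_triang Pv Pw).
  + move=> T' triT'; have disT' := dissection_diagonals triT'; split.
      move=> v [l [x [lL /coneP[c [c0 cS] ->] ->]]].
      exact: (dissection_combination_Pf n_ge4 lL disT').
    apply/seteqP; split=> y.
      move=> [v [l [x [lL /coneP[c [c0 cS] ->] ->]]] <-]; apply/coneP; exists c => //.
      rewrite [RHS]comb_ray; apply/(seed_proj_eqmod phi_ker); exists l => // e _.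
      by rewrite ffunE addrC.
    move=> /coneP[c [c0 cS] ->]; exists (comb (Wdiag R (n:=n)) c); last by rewrite [RHS]comb_ray.
    exists 0, (comb (Wdiag R (n:=n)) c); split; rewrite ?mem0v ?add0r //.
    by apply/coneP; exists c.
- exists (normal_fan P); split=> //.
    rewrite maxP; apply/seteqP; split=> C [M].
      by move=> /mx_dissectionP[T' triT' ->] ->; exists T'.
    by move=> triM ->; exists (diagonals M) => //; apply/mx_dissectionP; exists M.
  exists P; split=> //.
  + split; last exact: ncP.
    by split=> //; rewrite -cardJ.
  + move=> G; rewrite facP; split=> -[e]; rewrite ?dissection1 => nbe ->; exists e => //.
    by rewrite dissection1.
  + have pairsE : parallel_pairs P Wbar = [set [set e; rotate e] | e in diagonals T]%SET.
      apply/setP => p; rewrite inE; apply/asboolP/imsetP => [[e [f [nbe nbf ef -> par]]]|[e eT ->]].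
        have [||a ray_f] := parP1 e f _ _ par; rewrite ?dissection1 //.
        have opp := ray_proportional n_ge4 T_triang phi_ker nbe nbf ef ray_f.
        have [[eT ->]|[fT ->]] := ray_opposite n_ge4 T_triang phi_ker nbe nbf opp.
          by exists e.
        by exists f; rewrite // finset.setUC.
      have nbe : ~~ boundary e by move: eT; rewrite diagonalsP => /andP[].
      exists e, (rotate e); split=> //; first exact: rotate_nb.
        by apply: contraTneq (cross_rotate nbe) => <-; rewrite crossee.
      by apply: parP2; rewrite ?dissection1 ?rotate_nb //; exact: ray_rotate.
    (* Distinct seed diagonals give distinct pairs: otherwise one would be the rotation of the other
       and cross it. *)
    split=> //; rewrite pairsE card_in_imset ?card_diagonals // => e e' eT e'T eq_ee'.
    have : e \in [set e'; rotate e']%SET by rewrite -eq_ee' setU11.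
    rewrite finset.in_set2 => /orP[/eqP //|/eqP e_rot].
    move: eT e'T; rewrite !diagonalsP => /andP[eT _] /andP[e'T nbe'].
    by have := triangulation_nc T_triang e'T eT; rewrite e_rot cross_rotate.
- split.
    apply: independent_basis; first by apply/ind/dissection_diagonals.
    by rewrite cardJ card_diagonals.
  by move=> e _ _ i; exact: ray_coord.
Qed.
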